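(* Let $1<p<2<q<\infty$ satisfy $$\frac1p\ \ge\ \frac1q\log_2\binom{q}{q/2}.$$ Let $d\ge1$ be an integer, let $E\subseteq\{0,1\}^d$, and let $0\le r<1$. Assign to each $\omega\in\{0,1\}^d$ the matrix $$G_\omega(r):=\begin{cases}(1-r^2)^{-1/2}\begin{pmatrix}1&r\\ r&1\end{pmatrix},&\omega\in E,\\[1ex] I,&\omega\notin E,\end{cases}$$ and let $a_E(t;r)$, $t\in\mathbb{T}^d$, be the $(1,1)$-entry of the associated root matrix $P_\emptyset^{(d)}(t)$. Then $$\left\|\bigl(\log|a_E(\cdot;r)|^2\bigr)^{1/2}\right\|_{L^q(\mathbb{T}^d)}\le|E|^{1/p}\left(\log\frac1{1-r^2}\right)^{1/2}.$$
   Context: $\mathbb{T}=\mathbb{R}/\mathbb{Z}$ with normalized Haar measure, $\mathbb{T}^d$ with the product measure; $\log$ is the natural logarithm. For real $q>2$, $\binom{q}{q/2}:=\Gamma(q+1)/\Gamma(q/2+1)^2$. For $s\in\mathbb{R}$, $D(s):=\begin{pmatrix}e^{\pi i s}&0\\0&e^{-\pi i s}\end{pmatrix}$; conjugation $D(s)GD(s)^{-1}$ depends only on $s$ modulo $1$. For words $\sigma,\tau$ over $\{0,1\}$, $\sigma\tau$ is their concatenation, and $\{0,1\}^0=\{\emptyset\}$ with $\emptyset$ the empty word. Given matrices $(G_\omega)_{\omega\in\{0,1\}^d}$ in $\mathrm{SU}(1,1)$ (complex matrices $\begin{pmatrix}A&B\\ \overline{B}&\overline{A}\end{pmatrix}$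 with $|A|^2-|B|^2=1$), the root matrix $P_\emptyset^{(d)}(t_1,\dots,t_d)$ is obtained by setting $P_\omega^{(0)}:=G_\omega$ for $\omega\in\{0,1\}^d$ and, for $1\le n\le d$, $\sigma\in\{0,1\}^{d-n}$, $$P_\sigma^{(n)}(t_1,\dots,t_n):=P_{\sigma0}^{(n-1)}(t_1,\dots,t_{n-1})\,D(t_n)\,P_{\sigma1}^{(n-1)}(t_1,\dots,t_{n-1})\,D(t_n)^{-1}.$$ *)

(* Defs.v *)
From HB Require Import structures.
From mathcomp Require Import all_boot all_order all_algebra.
From mathcomp Require Import all_classical all_reals all_analysis.
From mathcomp Require Import complex.

Set Implicit Arguments.
Unset Strict Implicit.
Unset Printing Implicit Defensive.

Import Order.TTheory GRing.Theory Num.Theory.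
Import numFieldNormedType.Exports.

Local Open Scope classical_set_scope.
Local Open Scope ring_scope.
Local Open Scope complex_scope.

Section Gamma.
Variable R : realType.

(* Euler's integral; it converges for 0 < x, the only case in which [Gamma x]
   is meaningful. *)
Definition Gamma (x : R) : R :=
  \int[lebesgue_measure]_(t in `]0%R, +oo[%classic) (t `^ (x - 1) * expR (- t)).

Definition central_binomial (q : R) : R :=
  Gamma (q + 1) / Gamma (q / 2 + 1) ^+ 2.

Definition log2 (x : R) : R := ln x / ln 2.

End Gamma.

Section Torus.
Variable R : realType.

(* R/Z with its Haar measure is represented by its fundamental domain: real
   numbers distributed uniformly on [0, 1].  Functions on the torus are
   1-periodic functions of real variables; see [phase_mx_conj_periodic]. *)
Definition circle_measure : probability (measurableTypeR R) R :=
  uniform_prob (@ltr01 R).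

Definition tuple_rcons n (x : n.-tuple (measurableTypeR R) * measurableTypeR R)
  : n.+1.-tuple (measurableTypeR R) := [tuple of rcons x.1 x.2].

Lemma measurable_tuple_rcons n : measurable_fun setT (@tuple_rcons n).
Proof.
apply/measurable_fun_tnthP => i.
have [lin|nlei] := ltnP i n.
  rewrite (_ : _ \o _ = (@tnth n (measurableTypeR R) ^~ (Ordinal lin)) \o fst).
    by apply: measurableT_comp => //; exact: measurable_tnth.
  apply/funext => x /=.
  by rewrite !(tnth_nth 0) /= nth_rcons size_tuple lin.
rewrite (_ : _ \o _ = snd) //.
apply/funext => x /=.
have -> : i = ord_max by apply/val_inj/eqP; rewrite eqn_leq nlei -ltnS ltn_ord.
by rewrite (tnth_nth 0) /= nth_rcons size_tuple ltnn eqxx.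
Qed.

HB.instance Definition _ n := isMeasurableFun.Build _ _ _ _
  (@tuple_rcons n) (@measurable_tuple_rcons n).

(* The d-fold product of [circle_measure], carried from the iterated binary
   product to d-tuples. *)
Fixpoint torus_measure d : probability (d.-tuple (measurableTypeR R)) R :=
  match d with
  | 0 => dirac [tuple]
  | d'.+1 => distribution (torus_measure d' \x circle_measure)%E
               (@tuple_rcons d')
  end.

End Torus.

Section RootMatrix.
Variable R : realType.

Definition mx2 (a b c e : R[i]) : 'M[R[i]]_2 :=
  \matrix_(i < 2, j < 2)
    if i == ord0 then (if j == ord0 then a else b)
    else (if j == ord0 then c else e).

(* e^{i pi s} *)
Definition expipi (s : R) : R[i] := cos (pi * s) +i* sin (pi * s).

Definition phase_mx (s : R) : 'M[R[i]]_2 := mx2 (expipi s) 0 0 (expipi (- s)).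

Lemma phase_mx_conj_periodic (s : R) (G : 'M[R[i]]_2) :
  phase_mx (s + 1) *m G *m invmx (phase_mx (s + 1)) =
  phase_mx s *m G *m invmx (phase_mx s).
Proof.
have -> : phase_mx (s + 1) = - phase_mx s.
  have e1 : expipi (s + 1) = - expipi s.
    by rewrite /expipi mulrDr mulr1 cosDpi sinDpi.
  have e2 : expipi (- (s + 1)) = - expipi (- s).
    apply: oppr_inj; rewrite opprK -[in RHS](subrK 1 (- s)) -opprD.
    by rewrite /expipi mulrDr mulr1 cosDpi sinDpi.
  apply/matrixP => i j; rewrite !mxE e1 e2.
  by case: ifP => _; case: ifP => _; rewrite ?oppr0.
have invN : invmx (- phase_mx s) = - invmx (phase_mx s).
  have u1 : (-1 : R[i]) \is a GRing.unit by rewrite unitrN1.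
  rewrite -scaleN1r; have [Us|nUs] := boolP (phase_mx s \in unitmx).
    by rewrite invmxZ ?unitmxZ// invrN1 scaleN1r.
  by rewrite !invmx_out ?inE ?unitmxZ// scaleN1r.
by rewrite invN mulNmx mulmxN mulNmx opprK.
Qed.

(* Words over {0,1} are sequences of booleans, false standing for 0 and true
   for 1.  [node_mx G t n sigma] is P_sigma^(n)(t_1, ..., t_n) for a word sigma
   of length d - n; the leaves are then words of length d, so the default value
   1%:M is never reached.  The variable t_n is [t`_n.-1]. *)
Fixpoint node_mx d (G : d.-tuple bool -> 'M[R[i]]_2) (t : seq R) (n : nat)
    (sigma : seq bool) : 'M[R[i]]_2 :=
  match n with
  | 0 => oapp G 1%:M (insub sigma)
  | n'.+1 => node_mx G t n' (rcons sigma false) *m phase_mx t`_n'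
             *m node_mx G t n' (rcons sigma true) *m invmx (phase_mx t`_n')
  end.

Definition root_mx d (G : d.-tuple bool -> 'M[R[i]]_2) (t : d.-tuple R) :=
  node_mx G t d [::].

Definition leaf_mx d (E : {set d.-tuple bool}) (r : R) (w : d.-tuple bool)
    : 'M[R[i]]_2 :=
  if w \in E then ((Num.sqrt (1 - r ^+ 2))^-1)%:C *: mx2 1 r%:C r%:C 1
  else 1%:M.

Definition root_entry d (E : {set d.-tuple bool}) (r : R) (t : d.-tuple R)
    : R[i] := root_mx (leaf_mx E r) t ord0 ord0.

End RootMatrix.

(* Main.v *)
Require Import Defs.
From mathcomp Require Import all_boot all_order all_algebra.
From mathcomp Require Import all_classical all_reals all_analysis.
From mathcomp Require Import complex measurable_realfun ring lra.
Import Order.TTheory GRing.Theory Num.Theory.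
Import numFieldNormedType.Exports.
Set Implicit Arguments.
Unset Strict Implicit.
Unset Printing Implicit Defensive.
Local Open Scope classical_set_scope.
Local Open Scope ring_scope.

(** Write a = q/2 and let X, Y be the values of log |A|^2 at the two children of
a node.  At the node it is X + Y + log |1 + rho z|^2, where z is uniform on the
unit circle and rho^2 = (1 - e^(-X)) (1 - e^(-Y)).  The difference of
log |1 + rho z|^2 and 2 sqrt(XY) Re z is concave in Re z and nonnegative at
Re z = -1, so it changes sign at most once, from + to -; both functions have
mean zero, hence the second dominates the first in convex order and
E (X + Y + log |1 + rho z|^2)^a <= E |sqrt X + sqrt Y z|^q.

The linear inequality E |x + y z|^q <= (x^p + y^p)^(q/p) reduces to
M(rho) = E |1 + rho z|^q <= (1 + rho^p)^(q/p) for 0 <= rho <= 1.  The logarithmic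
gap between the two sides vanishes at 0 and is nonnegative at 1, where M(1) is
the central binomial coefficient.  By the hypergeometric differential equation
of M, at a zero of the derivative of the gap the sign of the second derivative
is that of p - q (rho^(2-p) - rho^p) / (1 - rho^2), which changes only once;
so the gap cannot become negative.

Minkowski's inequality with exponent q/p then shows that the p-th powers of the
norms of (log |A|^2)^(1/2) at the nodes are subadditive along the tree.

Since Gamma is only given by its integral, M(1) = binom(q, q/2) is approached
through the recurrence that both sides satisfy under q -> q + 2, as in the
Bohr-Mollerup theorem; only the upper bound on M(1) is needed. *)

(** * Means over the circle *)

Section CircleMean.
Context {R : realType}.
Implicit Types (f g F : R -> R) (a b : R).
Local Notation mu := (@lebesgue_measure R).

(** The hypothesis on p and q amounts to the case x = y of the linear two-point inequality; the rest
    of the argument propagates this endpoint to every ratio rho = y / x. In SU(1,1) one has |B|^2 /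
    |A|^2 = 1 - e^(-X) with X = log |A|^2, which is where rho comes from. The arguments of the
    entries merely translate the uniform phase, so X and Y alone govern the law at a node.
    Nonnegativity at Re z = -1 means rho <= 1 - e^(-sqrt(XY)), that is, concavity of log (1 - exp (-
    exp w)) in w. The obstacle in the linear part is the endpoint rho = 1: |1 + rho z|^2 vanishes at
    z = -1, while differentiation lowers its exponent, possibly below 0. All calculus is therefore
    done for |rho| < 1, and rho = 1 is reached by continuity. The hypergeometric equation is used as
    a first-order system for two functions [U] and [V] with M = U + V and rho M' = 2 a V; the
    derivative of the logarithmic gap then has the sign of rho^p U - V, and no second derivative of
    M has to be formed. *)

Definition cmean f : R := \int[mu]_(t in `[0, 1]) f t.

Lemma integrable_segment f a b : continuous f -> mu.-integrable `[a, b] (EFin \o f).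
Proof.
move=> cf; apply: continuous_compact_integrable; first exact: segment_compact.
exact: continuous_subspaceT.
Qed.

Lemma integrable_unit f : continuous f -> mu.-integrable `[0, 1] (EFin \o f).
Proof. exact: integrable_segment. Qed.

Lemma eq_cmean f g : (forall t, f t = g t) -> cmean f = cmean g.
Proof. by move=> fg; apply: eq_Rintegral => t _; exact: fg. Qed.

Lemma cmeanD f g : continuous f -> continuous g ->
  cmean (fun t => f t + g t) = cmean f + cmean g.
Proof. by move=> cf cg; apply: RintegralD => //; exact: integrable_unit. Qed.

Lemma cmeanB f g : continuous f -> continuous g ->
  cmean (fun t => f t - g t) = cmean f - cmean g.
Proof. by move=> cf cg; apply: RintegralB => //; exact: integrable_unit. Qed.

Lemma cmeanZ a f : continuous f -> cmean (fun t => a * f t) = a * cmean f.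
Proof. by move=> cf; apply: RintegralZl => //; exact: integrable_unit. Qed.

Lemma cmean_cst a : cmean (fun=> a) = a.
Proof.
rewrite /cmean Rintegral_cst//= lebesgue_measure_itv/= lte_fin ltr01.
by rewrite oppr0 adde0 mulr1.
Qed.

Lemma le_cmean f g : continuous f -> continuous g ->
  (forall t, f t <= g t) -> cmean f <= cmean g.
Proof.
by move=> cf cg fg; apply: le_Rintegral => //; exact: integrable_unit.
Qed.

Lemma cmean_ge f a : continuous f -> (forall t, a <= f t) -> a <= cmean f.
Proof.
by move=> cf af; rewrite -(cmean_cst a); apply: le_cmean => // t; exact: cvg_cst.
Qed.


Lemma Rintegral_FTC f F a b : a < b -> {within `[a, b], continuous f} ->
  {within `[a, b], continuous F} ->
  (forall x : R, a < x < b -> is_derive x 1 F (f x)) ->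
  \int[mu]_(t in `[a, b]) f t = F b - F a.
Proof.
move=> ab cf cF dF.
rewrite /Rintegral (@continuous_FTC2 _ f F)//.
- have [_ ? ?] := (continuous_within_itvP F ab).1 cF.
  by split => // x; rewrite in_itv/= => /dF[].
- by move=> x; rewrite in_itv/= => /dF xF; rewrite derive1E; apply: derive_val.
Qed.

Lemma cmean_FTC f F : continuous f -> (forall x : R, is_derive x 1 F (f x)) ->
  cmean f = F 1 - F 0.
Proof.
move=> cf dF; apply: Rintegral_FTC => //; try exact: continuous_subspaceT.
by apply: continuous_subspaceT => x; apply/differentiable_continuous/derivable1_diffP; have
  [] := dF x.
Qed.

Lemma antiderivative f (N : R) : continuous f ->
  exists F, forall x : R, - N < x < N -> is_derive x 1 F (f x).
Proof.
move=> cf; exists (fun x => \int[mu]_(t in `[- N, x]) f t) => x /andP[Nx xN].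
have [dF F'] := continuous_FTC1_closed xN (integrable_segment (- N) N cf) Nx (cf x).
apply: DeriveDef; [exact: dF|rewrite -derive1E; exact: F'].
Qed.

(** If G is an antiderivative of g, then G (x + 1) - G x has derivative g (x + 1) - g x = 0, so it
    takes the same value at 0 and at s. *)
Lemma cmean_shift g (s : R) : continuous g -> (forall t, g (t + 1) = g t) ->
  cmean (fun t => g (t + s)) = cmean g.
Proof.
move=> cg pg.
(* Antiderivatives are available on a bounded window only; this one contains [0, 1] and [s, s + 1]
   in its interior. *)
pose N := `|s| + 2.
have [G dG] := antiderivative N cg.
have s0 : 0 <= `|s| by [].
have N1 : 1 < N by rewrite /N; lra.
have [lt_Ns lt_sN] : - N < s - 1 /\ s + 1 < N.
  by rewrite /N; split; [have := ler_norm (- s); rewrite normrN; lra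
                       |have := ler_norm s; lra].
have dGs (x y : R) : - N < x + y < N -> is_derive x 1 (fun t => G (t + y)) (g (x + y)).
  move=> xyN.
  have := @is_derive1_comp _ G (fun t => t + y) x (g (x + y)) 1 (dG _ xyN).
  rewrite mulr1; apply.
  by rewrite -[X in is_derive _ _ _ X](addr0 1); apply: is_deriveD.
have ctr (h : R -> R) (x : R) l : is_derive x 1 h l -> {for x, continuous h}.
  by move=> [dh _]; apply/differentiable_continuous/derivable1_diffP.
have cgs (y : R) : continuous (fun t => g (t + y)).
  move=> x; apply: (@continuous_comp _ _ _ (fun t => t + y) g); last exact: cg.
  by apply: cvgD; [exact: cvg_id|exact: cvg_cst].
have mG (y : R) : - N < y -> 1 + y < N ->
    cmean (fun t => g (t + y)) = G (1 + y) - G y.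
  move=> y1 y2; rewrite -[in X in _ - G X](add0r y).
  apply: (@Rintegral_FTC (fun t => g (t + y)) (fun t => G (t + y))) => //.
  - exact: continuous_subspaceT.
  - apply: derivable_within_continuous => x; rewrite in_itv/= => /andP[x0 x1].
    by have [] := dGs x y; first by apply/andP; split; lra.
  - by move=> x /andP[x0 x1]; apply: dGs; apply/andP; split; lra.
have dK (x : R) : - N < x -> 1 + x < N ->
    is_derive x 1 (fun t => G (t + 1) - G t) 0.
  move=> y1 y2; rewrite -[X in is_derive _ _ _ X](subrr (g x)).
  apply: is_deriveB; last by apply: dG; apply/andP; split; lra.
  by rewrite -(pg x); apply: dGs; apply/andP; split; lra.
have K0 x y : - N < x -> 1 + x < N -> - N < y -> 1 + y < N -> x < y ->
    G (x + 1) - G x = G (y + 1) - G y.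
  move=> ? ? ? ? xy; apply/eqP; rewrite eq_sym -subr_eq0; apply/eqP.
  have [z|//|z _ ->] := @MVT _ (fun t => G (t + 1) - G t) (fun=> 0) x y xy.
  - by rewrite in_itv/= => /andP[? ?]; apply: dK; lra.
  - apply: derivable_within_continuous => z; rewrite in_itv/= => /andP[? ?].
    by have [] := dK z ltac:(lra) ltac:(lra).
  - by rewrite mul0r.
have -> : cmean g = G (0 + 1) - G 0.
  rewrite (addrC 0 1) -mG; [|lra..].
  by apply: eq_cmean => t; rewrite addr0.
rewrite mG; [|lra..]; rewrite (addrC 1).
by have [s_lt0|s_gt0|->//] := ltgtP s 0; [|symmetry]; apply: K0 => //; lra.
Qed.

(** The circle has finite mass, so a constant K can dominate the differentiated integrand. *)
Lemma is_derive_cmean (f f' : R -> R -> R) (u v a K : R) : u < a < v ->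
  (forall x t : R, u < x < v -> is_derive x 1 (f ^~ t) (f' x t)) ->
  (forall x, u < x < v -> continuous (f x)) ->
  (forall x t : R, u < x < v -> 0 <= t <= 1 -> `|f' x t| <= K) ->
  is_derive a 1 (fun x => cmean (f x)) (cmean (f' a)).
Proof.
move=> auv df cf bf.
have Ia : `]u, v[%classic a by rewrite /= in_itv/=.
have m01 : measurable (`[0, 1] : set (measurableTypeR R)) by [].
have K0 : 0 <= K by apply: le_trans (bf a 0 auv _); rewrite ?lexx ?ler01.
have i1 x : `]u, v[%classic x -> mu.-integrable `[0, 1] (EFin \o f x).
  by rewrite /= in_itv/= => xuv; apply: integrable_unit; exact: cf.
have i2 x y : `]u, v[%classic x -> `[0, 1]%classic y -> derivable (f ^~ y) x 1.
  by rewrite /= in_itv/= => xuv _; have [] := df x y xuv.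
have i3 : mu.-integrable `[0, 1] (EFin \o (fun=> K)).
  by apply: integrable_unit => t; exact: cvg_cst.
have d1 x y : u < x < v -> derive1 (f ^~ y) x = f' x y.
  by move=> /df xd; rewrite derive1E; apply: derive_val.
have i4 x y : `]u, v[%classic x -> `[0, 1]%classic y -> `| derive1 (f ^~ y) x | <= K.
  by rewrite /= !in_itv/= => xuv y01; rewrite d1// bf.
apply: DeriveDef.
- exact: (@derivable_under_integral _ _ _ mu f `[0, 1] m01 a u v Ia i1 i2 (fun=> K) (fun=>
  K0) i3 i4).
- rewrite -derive1E.
  rewrite (@differentiation_under_integral _ _ _ mu f `[0, 1] m01 a u v Ia i1 i2 (fun=> K)
    (fun=> K0) i3 i4).
  by apply: eq_cmean => t; exact: d1.
Qed.

End CircleMean.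

(** * Moments of the Poisson denominator *)

Section PowerFunctions.
Context {R : realType}.
Implicit Types (f g : R -> R) (a b x y : R).

Lemma is_derive_continuous f x l : is_derive x 1 f l -> {for x, continuous f}.
Proof. by move=> [df _]; apply/differentiable_continuous/derivable1_diffP. Qed.

Lemma is_derive_ext f g x l l' : is_derive x 1 f l -> f =1 g -> l = l' ->
  is_derive x 1 g l'.
Proof. by move=> df /funext <- <-. Qed.

Lemma is_derive_inv x : x != 0 -> is_derive x 1 (fun y => y^-1) (- x ^- 2).
Proof.
move=> x0; have := @is_deriveV R id x 1 1 x0 (is_derive_id x 1).
by move=> H; apply: (is_derive_ext H) => //; rewrite /GRing.scale/= mulr1.
Qed.

Lemma is_derive_chain (phi g : R -> R) x l m :
  is_derive (g x) 1 phi l -> is_derive x 1 g m ->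
  is_derive x 1 (fun y => phi (g y)) (l * m).
Proof. exact: (@is_derive1_comp _ phi g). Qed.

Lemma is_derive_div f g x l m : g x != 0 -> is_derive x 1 f l ->
  is_derive x 1 g m ->
  is_derive x 1 (fun y => f y / g y) (l / g x - f x * m / g x ^+ 2).
Proof.
move=> gx0 df dg; have dV := is_derive_chain (is_derive_inv gx0) dg.
apply: (is_derive_ext (is_deriveM df dV)) => //.
by rewrite /GRing.scale/=; field.
Qed.

Lemma is_derive_powR b y : 0 < y ->
  is_derive y 1 (fun x => x `^ b) (b * y `^ (b - 1)).
Proof.
move=> y0; have yI : y \in `]0, +oo[ by rewrite in_itv/= y0.
apply: DeriveDef; first exact: derivable_powR.
by rewrite -derive1E; exact: powR_derive1.
Qed.

Lemma continuous_powR b y : 0 < y -> {for y, continuous (fun x => x `^ b)}.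
Proof. by move=> /(is_derive_powR b)/is_derive_continuous. Qed.

(** For negative x the power is a default value; the absolute value is what gives continuity at
    0. *)
Lemma continuous_norm_powR b : 0 <= b -> continuous (fun x => `|x| `^ b).
Proof.
rewrite le_eqVlt => /predU1P[<- x|b0 x].
  have -> : (fun x => `|x| `^ 0) = fun=> 1 by apply/funext => y; rewrite powRr0.
  exact: cvg_cst.
have [->|x0] := eqVneq x 0; last first.
  apply: (@continuous_comp _ _ _ (fun x => `|x|) (fun x => x `^ b)).
    exact: norm_continuous.
  by apply: continuous_powR; rewrite normr_gt0.
apply/cvgrPdist_le => e e0; rewrite normr0 powR0 ?gt_eqF//; near=> t.
rewrite sub0r normrN ger0_norm ?powR_ge0//.
have -> : e = (e `^ b^-1) `^ b by rewrite -powRrM mulVf ?gt_eqF// powRr1// ltW.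
apply: ge0_ler_powR; rewrite ?nnegrE ?powR_ge0 ?(ltW b0)//.
apply: ltW; near: t; apply: cvgr0_norm_lt; [exact: cvg_id|exact: powR_gt0].
Unshelve. all: by end_near. Qed.

Lemma continuous_comp_powR f b : 0 <= b -> continuous f -> (forall t, 0 <= f t) ->
  continuous (fun t => f t `^ b).
Proof.
move=> b0 cf f0.
have -> : (fun t => f t `^ b) = (fun x => `|x| `^ b) \o f.
  by apply/funext => t /=; rewrite ger0_norm.
by move=> t; apply: continuous_comp; [exact: cf|exact: continuous_norm_powR].
Qed.

Lemma continuous_comp_gt0 (phi : R -> R) f :
  (forall y, 0 < y -> {for y, continuous phi}) ->
  continuous f -> (forall t, 0 < f t) -> continuous (fun t => phi (f t)).
Proof.
by move=> cphi cf f0 t; apply: (@continuous_comp _ _ _ f phi);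
  [exact: cf|exact: cphi].
Qed.

End PowerFunctions.

(** * Moments of |1 + rho z|^2 and their differential system *)

Section PoissonSystem.
Context {R : realType}.
Implicit Types (a b rho t : R).

Definition cosT t : R := cos (2 * pi * t).
Definition sinT t : R := sin (2 * pi * t).

Lemma is_derive_cosT t : is_derive t 1 cosT (- (2 * pi) * sinT t).
Proof.
have dl : is_derive t 1 (fun t : R => 2 * pi * t) (2 * pi).
  rewrite -[X in is_derive _ _ _ X]mulr1; exact: is_deriveZ.
have := @is_derive1_comp _ cos (fun t => 2 * pi * t) t _ _ (is_derive_cos _) dl.
by rewrite mulNr [X in - X]mulrC -mulNr.
Qed.

Lemma is_derive_sinT t : is_derive t 1 sinT (2 * pi * cosT t).
Proof.
have dl : is_derive t 1 (fun t : R => 2 * pi * t) (2 * pi).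
  rewrite -[X in is_derive _ _ _ X]mulr1; exact: is_deriveZ.
have := @is_derive1_comp _ sin (fun t => 2 * pi * t) t _ _ (is_derive_sin _) dl.
by rewrite [_ * (2 * pi)]mulrC.
Qed.

Lemma continuous_cosT : continuous cosT.
Proof. by move=> t; exact: is_derive_continuous (is_derive_cosT t). Qed.

Lemma cosT_bound t : -1 <= cosT t <= 1.
Proof. by rewrite cos_geN1 cos_le1. Qed.

Lemma cosTD1 t : cosT (t + 1) = cosT t.
Proof. by rewrite /cosT mulrDr mulr1 [X in _ + X]mulr_natl cosD2pi. Qed.

Lemma sinT0 : sinT 0 = 0. Proof. by rewrite /sinT mulr0 sin0. Qed.

Lemma sinT1 : sinT 1 = 0.
Proof. by rewrite /sinT mulr1 mulr_natl sin2pi. Qed.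

Lemma sinT2 t : sinT t ^+ 2 = 1 - cosT t ^+ 2.
Proof. exact: sin2cos2. Qed.

(* |1 + rho e^(2 pi i t)|^2 *)
Definition poisson_den rho t : R := 1 + rho ^+ 2 + 2 * rho * cosT t.
Local Notation u := poisson_den.

Lemma poisson_den_ge0 rho t : 0 <= u rho t.
Proof.
have -> : u rho t = (rho + cosT t) ^+ 2 + (1 - cosT t ^+ 2) by rewrite /u; ring.
by rewrite -sinT2 addr_ge0// sqr_ge0.
Qed.

(** For rho in a compact part of ]-1, 1[ the denominator stays in a segment away from 0, uniformly
    in t; this supplies the dominating constants below. *)
Lemma poisson_den_bound rho (s : R) t : -s <= rho <= s -> s <= 1 ->
  (1 - s) ^+ 2 <= u rho t <= 4.
Proof.
move=> /andP[s1 s2] s3; have /andP[c1 c2] := cosT_bound t; rewrite /u.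
have [r0|r0] := leP 0 rho.
(* With u the denominator, u - (1 - s)^2 is twice the product in [h1] plus that in [h3], and 4 - u
   is twice that in [h2] plus that in [h4]. *)
- have h1 : 0 <= rho * (1 + cosT t) by rewrite mulr_ge0//; lra.
  have h2 : 0 <= rho * (1 - cosT t) by rewrite mulr_ge0//; lra.
  have h3 : 0 <= (s - rho) * (2 - s - rho) by rewrite mulr_ge0//; lra.
  have h4 : 0 <= (1 - rho) * (3 + rho) by rewrite mulr_ge0//; lra.
  by apply/andP; split; nra.
- have h1 : 0 <= - rho * (1 + cosT t) by rewrite mulr_ge0//; lra.
  have h2 : 0 <= - rho * (1 - cosT t) by rewrite mulr_ge0//; lra.
  have h3 : 0 <= (s + rho) * (2 - s + rho) by rewrite mulr_ge0//; lra.
  have h4 : 0 <= (1 + rho) * (3 - rho) by rewrite mulr_ge0//; lra.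
  by apply/andP; split; nra.
Qed.

Lemma poisson_den_gt0 rho t : -1 < rho < 1 -> 0 < u rho t.
Proof.
rewrite -ltr_norml => r1.
have /(poisson_den_bound t)/(_ (ltW r1))/andP[+ _] : - `|rho| <= rho <= `|rho|.
  by rewrite -ler_norml.
by apply: lt_le_trans; rewrite exprn_gt0// subr_gt0.
Qed.

Lemma continuous_poisson_den rho : continuous (u rho).
Proof.
move=> t; apply: cvgD; first exact: cvg_cst.
by apply: cvgM; [exact: cvg_cst|exact: continuous_cosT].
Qed.

Lemma is_derive_poisson_den1 rho t :
  is_derive rho 1 (u ^~ t) (2 * rho + 2 * cosT t).
Proof.
have h := is_deriveD (is_deriveD (is_derive_cst (1:R) rho 1)
  (is_deriveM (is_derive_id rho (1:R)) (is_derive_id rho (1:R))))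
  (is_deriveZ (2 * cosT t) (is_derive_id rho (1:R))).
apply: (is_derive_ext h) => [r|]; last by rewrite /GRing.scale/=; ring.
by change (1 + r * r + 2 * cosT t * r = u r t); rewrite /u; ring.
Qed.

Lemma is_derive_poisson_den2 rho t :
  is_derive t 1 (u rho) (2 * rho * (- (2 * pi) * sinT t)).
Proof.
have := is_deriveD (is_derive_cst (1 + rho ^+ 2) t 1) (is_deriveZ (2 * rho) (is_derive_cosT t)).
by move=> /is_derive_eq; apply; rewrite add0r.
Qed.

(** [phi] is general because both powers and the logarithm are differentiated in this way. *)
Lemma is_derive_cmean_comp (phi phi' g : R -> R) rho :
  (forall y : R, 0 < y -> is_derive y 1 phi (phi' y)) ->
  (forall y, 0 < y -> {for y, continuous phi'}) -> continuous g ->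
  -1 < rho < 1 ->
  is_derive rho 1 (fun rho => cmean (fun t => phi (u rho t) * g t))
    (cmean (fun t => phi' (u rho t) * (2 * rho + 2 * cosT t) * g t)).
Proof.
move=> dphi cphi' cg /andP[r1 r2].
(* The midpoint of |rho| and 1: rho is interior to [-s, s], where the denominator is at least (1 -
   s)^2 > 0. *)
pose s := (1 + `|rho|) / 2.
have rn : `|rho| < 1 by rewrite ltr_norml r1 r2.
have r0 : 0 <= `|rho| by [].
have /andP[rs1 rs2] : - s < rho < s.
  by rewrite -ltr_norml /s; lra.
have s1 : s < 1 by rewrite /s; lra.
have s0 : 0 < s by rewrite /s; lra.
have s2 : 0 < (1 - s) ^+ 2 by rewrite exprn_gt0// subr_gt0.
have le_s4 : (1 - s) ^+ 2 <= 4 by nra.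
have [K1 bK1] : exists K, forall y, (1 - s) ^+ 2 <= y <= 4 -> `|phi' y| <= K.
  have [|c _ hc] := @EVT_max R (fun y => `|phi' y|) ((1 - s) ^+ 2) 4 le_s4.
    apply: (@continuous_in_subspaceT _ _ _ _) => y; rewrite inE/= in_itv/= => /andP[y1 _].
    apply: (@continuous_comp _ _ _ phi' (fun x => `|x|)); last exact: norm_continuous.
    by apply: cphi'; apply: lt_le_trans y1.
  by exists (`|phi' c|) => y yI; apply: hc; rewrite in_itv.
have [K2 bK2] : exists K, forall t, 0 <= t <= 1 -> `|g t| <= K.
  have [|c _ hc] := @EVT_max R (fun y => `|g y|) 0 1 ler01.
    apply: continuous_subspaceT => y.
    by apply: (@continuous_comp _ _ _ g (fun x => `|x|)); [exact: cg|exact: norm_continuous].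
  by exists (`|g c|) => y yI; apply: hc; rewrite in_itv.
(* [K1] bounds phi' on [(1 - s)^2, 4], 4 bounds the derivative of the denominator in rho, and [K2]
   bounds g. *)
apply: (@is_derive_cmean R _ (fun rho t => phi' (u rho t) * (2 * rho + 2 * cosT t) * g t) (-
  s) s rho (K1 * 4 * K2)).
- by rewrite rs1 rs2.
- move=> x t /andP[x1 x2].
  have x3 : - 1 < x < 1 by lra.
  have d1 := @is_derive1_comp _ phi (u ^~ t) x _ _ (dphi _ (poisson_den_gt0 t x3))
    (is_derive_poisson_den1 x t).
  have := is_deriveZ (g t) d1.
  set h := (X in is_derive _ _ X _); have -> : h = (fun x => phi (u x t) * g t).
    by apply/funext => y; rewrite /h !fctE mulrC.
  by move=> /is_derive_eq; apply; rewrite /GRing.scale/= mulrC.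
- move=> x /andP[x1 x2]; have x3 : - 1 < x < 1 by lra.
  move=> t; apply: cvgM; last exact: cg.
  apply: continuous_comp_gt0 => [y /dphi/is_derive_continuous //||t'].
    exact: continuous_poisson_den.
  exact: poisson_den_gt0.
- move=> x t /andP[x1 x2] t01; rewrite !normrM.
  have xs : - s <= x <= s by rewrite !ltW.
  have /bK1 k1 := poisson_den_bound t xs (ltW s1).
  have k2 := bK2 t t01.
  have k3 : `|2 * x + 2 * cosT t| <= 4.
    by have /andP[c1 c2] := cosT_bound t; rewrite ler_norml; apply/andP; split; lra.
  by rewrite ler_pM// ler_pM.
Qed.

Lemma continuous_poisson_phi (phi g : R -> R) rho :
  (forall y, 0 < y -> {for y, continuous phi}) -> continuous g ->
  -1 < rho < 1 -> continuous (fun t => phi (u rho t) * g t).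
Proof.
move=> cphi cg r1 t; apply: cvgM; last exact: cg.
apply: continuous_comp_gt0 => //; first exact: continuous_poisson_den.
by move=> ?; exact: poisson_den_gt0.
Qed.

(** The case j = 0, b = a is M. Powers of the cosine are carried along because differentiation in
    rho produces the factor 2 rho + 2 cos. *)
Definition pmoment b (j : nat) rho := cmean (fun t => u rho t `^ b * cosT t ^+ j).
Local Notation S := pmoment.

Lemma continuous_cosTX j : continuous (fun t => cosT t ^+ j).
Proof. by move=> t; apply: (@continuous_comp _ _ _ cosT (fun x => x ^+ j)); [exact:
  continuous_cosT|exact: exprn_continuous]. Qed.

Lemma continuous_pmoment_fun b j rho : -1 < rho < 1 ->
  continuous (fun t => u rho t `^ b * cosT t ^+ j).
Proof.
move=> r1; apply: (@continuous_poisson_phi (fun x => x `^ b)) => //.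
  by move=> y; exact: continuous_powR.
exact: continuous_cosTX.
Qed.

Lemma pmoment_succ b j rho : -1 < rho < 1 ->
  S (b + 1) j rho = (1 + rho ^+ 2) * S b j rho + 2 * rho * S b j.+1 rho.
Proof.
move=> r1; rewrite /S -!cmeanZ; [|exact: continuous_pmoment_fun..].
rewrite -cmeanD; last 2 first.
- by move=> t; apply: cvgM; [exact: cvg_cst|exact: continuous_pmoment_fun].
- by move=> t; apply: cvgM; [exact: cvg_cst|exact: continuous_pmoment_fun].
apply: eq_cmean => t; have u0 := poisson_den_gt0 t r1.
rewrite powRD; last by rewrite (gt_eqF u0) implybT.
rewrite (powRr1 (ltW u0)) (exprS (cosT t) j); move: (_ `^ b) => y; rewrite /poisson_den; ring.
Qed.

Lemma is_derive_pmoment b j rho : -1 < rho < 1 ->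
  is_derive rho 1 (S b j)
    (b * (2 * rho * S (b - 1) j rho + 2 * S (b - 1) j.+1 rho)).
Proof.
move=> r1.
have cb (y : R) : 0 < y -> {for y, continuous (fun x => b * x `^ (b - 1))}.
  by move=> y0; apply: cvgM; [exact: cvg_cst|exact: continuous_powR].
have H := is_derive_cmean_comp (@is_derive_powR _ b) cb (@continuous_cosTX j) r1.
apply: (is_derive_ext H) => //.
rewrite /S -!cmeanZ; [|exact: continuous_pmoment_fun..].
rewrite -cmeanD; last 2 first.
- by move=> t; apply: cvgM; [exact: cvg_cst|exact: continuous_pmoment_fun].
- by move=> t; apply: cvgM; [exact: cvg_cst|exact: continuous_pmoment_fun].
rewrite -cmeanZ; last first.
  move=> t; apply: cvgD.
  - by apply: cvgM; [exact: cvg_cst|exact: continuous_pmoment_fun].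
  - by apply: cvgM; [exact: cvg_cst|exact: continuous_pmoment_fun].
by apply: eq_cmean => t; rewrite exprS; ring.
Qed.

(* The derivative of the periodic function sin(2 pi t) u^b has mean zero. *)
Lemma pmoment_by_parts b rho : -1 < rho < 1 ->
  S b 1 rho = 2 * rho * b * (S (b - 1) 0 rho - S (b - 1) 2 rho).
Proof.
move=> r1.
pose f t := u rho t `^ b * cosT t ^+ 1 - 2 * rho * b * (u rho t `^ (b - 1) * cosT t ^+ 0 - u
  rho t `^ (b - 1) * cosT t ^+ 2).
have cu j b' : continuous (fun t => u rho t `^ b' * cosT t ^+ j) by exact: continuous_pmoment_fun.
have cf0 : continuous (fun t => 2 * rho * b * (u rho t `^ (b - 1) * cosT t ^+ 0 - u rho t `^
  (b - 1) * cosT t ^+ 2)).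
  by move=> t; apply: cvgM; [exact: cvg_cst|apply: cvgB; exact: cu].
have cf : continuous f by move=> t; apply: cvgB; [exact: cu|exact: cf0].
have df t : is_derive t 1 (fun t => sinT t * u rho t `^ b) (2 * pi * f t).
  have u0 := poisson_den_gt0 t r1.
  have d1 := @is_derive1_comp _ (fun x => x `^ b) (u rho) t _ _ (is_derive_powR b u0)
    (is_derive_poisson_den2 rho t).
  have /is_derive_eq := is_deriveM (is_derive_sinT t) d1.
  apply; rewrite /GRing.scale/= /f expr0 expr1.
  transitivity (2 * pi * (cosT t * u rho t `^ b - 2 * rho * b * u rho t `^ (b - 1) * sinT t ^+ 2)).
    by ring.
  by rewrite sinT2; ring.
have := @cmean_FTC _ (fun t => 2 * pi * f t) _ _ df.
rewrite sinT0 sinT1 !mul0r subr0 cmeanZ// => H.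
have {H} : cmean f = 0.
  have H1 : 2 * pi * cmean f = 0.
    by apply: H => t; apply: cvgM; [exact: cvg_cst|exact: cf].
  by apply/eqP; move/eqP: H1; rewrite mulf_eq0 gt_eqF// mulr_gt0// pi_gt0.
rewrite /f cmeanB; [|exact: cu|exact: cf0].
rewrite cmeanZ; last by move=> t; apply: cvgB; exact: cu.
rewrite cmeanB; [|exact: cu..].
by move/eqP; rewrite subr_eq0 => /eqP.
Qed.

(** [poissonU] and [poissonV] put the hypergeometric equation into first-order form: M = U + V, rho
    M' = 2 a V, and the derivatives of U and V involve only the moments of exponent a - 1, which for
    0 < rho < 1 are in turn linear in U and V. *)
Definition poissonU a rho := S (a - 1) 0 rho + rho * S (a - 1) 1 rho.
Definition poissonV a rho := rho ^+ 2 * S (a - 1) 0 rho + rho * S (a - 1) 1 rho.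
Local Notation U := poissonU.
Local Notation V := poissonV.

Lemma pmoment0E a rho : -1 < rho < 1 -> S a 0 rho = U a rho + V a rho.
Proof. by move=> r1; rewrite -{1}(subrK 1 a) pmoment_succ// /U /V; ring. Qed.

(** The chain rule leaves moments of exponent a - 2. The two sides are matched there by lowering one
    copy of [S (a - 1) 1] with [pmoment_succ] and integrating another by parts. *)
Lemma is_derive_poissonU a rho : -1 < rho < 1 ->
  is_derive rho 1 (U a) (2 * a * S (a - 1) 1 rho).
Proof.
move=> r1.
have dU := is_deriveD (is_derive_pmoment (a - 1) 0 r1)
  (is_deriveM (is_derive_id rho (1 : R)) (is_derive_pmoment (a - 1) 1 r1)).
have E := pmoment_by_parts (a - 1) r1.
apply: (is_derive_ext dU) => //.
have -> : 2 * a * S (a - 1) 1 rho = 2 * S (a - 1) 1 rho + 2 * (a - 1) * S (a - 1) 1 rho by ring.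
rewrite -[in X in _ = _ + X](subrK 1 (a - 1)) pmoment_succ// {2}/GRing.scale/= mulr1 {2}E
  /GRing.scale/=.
rewrite [in RHS]mulr_natl [in RHS]mulr2n {1}E; ring.
Qed.

Lemma is_derive_poissonV a rho : -1 < rho < 1 ->
  is_derive rho 1 (V a) (2 * a * rho * S (a - 1) 0 rho).
Proof.
move=> r1.
have dV := is_deriveD (is_deriveM (is_deriveM (is_derive_id rho (1:R)) (is_derive_id rho
  (1:R))) (is_derive_pmoment (a - 1) 0 r1))
  (is_deriveM (is_derive_id rho (1 : R)) (is_derive_pmoment (a - 1) 1 r1)).
have E := pmoment_by_parts (a - 1) r1.
apply: (is_derive_ext dV) => [r|]; first by rewrite !fctE -expr2.
rewrite /GRing.scale/=.
have -> : 2 * a * rho * S (a - 1) 0 rho = 2 * rho * S (a - 1) 0 rho + 2 * (a - 1) * rho * S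
  (a - 1) 0 rho by ring.
rewrite -[in X in _ = _ + X](subrK 1 (a - 1)) pmoment_succ// !fctE E; ring.
Qed.

(** Jensen's formula for 1 + rho z, obtained from the system at a = 0: [V 0] has zero derivative and
    vanishes at 0, and 2 V / rho is the derivative of the mean of the logarithm. *)
Lemma cmean_ln_poisson_den rho : 0 <= rho < 1 -> cmean (fun t => ln (u rho t)) = 0.
Proof.
move=> /andP[r0 r1].
have ln0 : cmean (fun t => ln (u 0 t)) = 0.
  rewrite -[RHS](@cmean_cst R 0); apply: eq_cmean => t.
  by rewrite /poisson_den expr0n mulr0 mul0r !addr0 ln1.
move: r0; rewrite le_eqVlt => /predU1P[<-//|r0].
have V0 x : 0 < x < 1 -> V 0 x = 0.
  move=> /andP[x0 x1].
  have [w|w|z _] := @MVT _ (V 0) (fun y => 2 * 0 * y * S (0 - 1) 0 y) 0 x x0.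
  - by rewrite in_itv/= => /andP[? ?]; apply: is_derive_poissonV; apply/andP; split; lra.
  - apply: derivable_within_continuous => y; rewrite in_itv/= => /andP[? ?].
    by have [] := @is_derive_poissonV 0 y ltac:(lra).
  - by rewrite mulr0 !mul0r {2}/poissonV expr0n !mul0r addr0 subr0.
have dln (x : R) : -1 < x < 1 -> is_derive x 1 (fun x => cmean (fun t => ln (u x t)))
    (2 * x * S (0 - 1) 0 x + 2 * S (0 - 1) 1 x).
  move=> x1.
  have c1 : continuous (fun _ : R => 1 : R) by move=> t; exact: cvg_cst.
  have H := @is_derive_cmean_comp (@ln R) (fun y => y^-1) (fun=> 1) x (fun y y0 =>
    is_derive1_ln y0) (fun y y0 => @inv_continuous _ y (lt0r_neq0 y0)) c1 x1.
  apply: (is_derive_ext H) => [y|]; first by apply: eq_cmean => t; rewrite mulr1.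
  rewrite /S -!cmeanZ; [|exact: continuous_pmoment_fun..].
  rewrite -cmeanD; last 2 first.
  - by move=> t; apply: cvgM; [exact: cvg_cst|exact: continuous_pmoment_fun].
  - by move=> t; apply: cvgM; [exact: cvg_cst|exact: continuous_pmoment_fun].
  apply: eq_cmean => t; rewrite sub0r powR_inv1 ?ltW ?poisson_den_gt0//.
  by rewrite expr0 expr1; ring.
have [w|w|z] := @MVT _ (fun x => cmean (fun t => ln (u x t))) (fun x => 2 * x * S (0 - 1) 0 x
  + 2 * S (0 - 1) 1 x) 0 rho r0.
- by rewrite in_itv/= => /andP[? ?]; apply: dln; apply/andP; split; lra.
- apply: derivable_within_continuous => y; rewrite in_itv/= => /andP[? ?].
  by have [] := dln y ltac:(lra).
- rewrite in_itv/= ln0 subr0 => /andP[z0 zr] ->.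
  have := V0 z ltac:(lra); rewrite /V.
  have -> : z ^+ 2 * S (0 - 1) 0 z + z * S (0 - 1) 1 z = z * (z * S (0 - 1) 0 z + S (0 - 1) 1
    z) by ring.
  move/eqP; rewrite mulf_eq0 gt_eqF//= => /eqP H.
  by rewrite -mulrA -mulrDr H mulr0 mul0r.
Qed.

End PoissonSystem.

(** * The two-point inequality *)

Section Crossings.
Context {R : realType}.
Implicit Types (f : R -> R) (a b : R).

(** z is the last point where f is nonnegative; f is negative right after it, so f' z cannot be
    positive. *)
Lemma downcrossing (f f' : R -> R) a b : a < b ->
  (forall x : R, a <= x <= b -> is_derive x 1 f (f' x)) -> 0 <= f a -> f b < 0 ->
  exists z, [/\ a <= z < b, f z = 0 & f' z <= 0].
Proof.
move=> ab df fa fb.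
pose A := [set x | a <= x <= b /\ 0 <= f x].
have Aa : A a by rewrite /A/= lexx ltW.
have ubA : ubound A b by move=> x [/andP[]].
have supA : has_sup A by split; [exists a|exists b].
pose z := sup A.
have az : a <= z by apply: sup_upper_bound.
have zb : z <= b by apply: sup_le_ub => //; exists a.
have abz : a <= z <= b by rewrite az zb.
have lt_f0 x : z < x <= b -> f x < 0.
  move=> /andP[zx xb]; rewrite ltNge; apply/negP => fx.
  have /(sup_upper_bound supA) : A x by rewrite /A/= xb (le_trans az (ltW zx)).
  by rewrite leNgt zx.
(* In Carathéodory's form f x - f z = g x (x - z) with g continuous at z, a positive f' z would make
   f positive just after z. *)
have /is_derive1_caratheodory[g [fg cg gz]] := df z abz.
have cf := is_derive_continuous (df z abz).
have fz : f z = 0.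
  apply/eqP; rewrite eq_le; apply/andP; split; rewrite leNgt; apply/negP => fz0.
    have zb' : z < b.
      by rewrite lt_neqAle zb andbT; apply: contraTneq fz0 => ->; rewrite -leNgt ltW.
    have [e /= e0 he] := @cvgr_gt _ _ _ _ _ (f z) cf 0 fz0.
    pose x := Num.min (z + e / 2) b.
    have zx : z < x by rewrite lt_min zb' andbT; lra.
    have xb : x <= b by rewrite ge_min lexx orbT.
    have xe : x <= z + e / 2 by rewrite ge_min lexx.
    have : 0 < f x.
      by apply: he; rewrite /= distrC gtr0_norm; lra.
    by rewrite ltNge ltW// lt_f0// zx xb.
  have [e /= e0 he] := @cvgr_lt _ _ _ _ _ (f z) cf 0 fz0.
  have [x [/andP[ax xb] fx] zx] := sup_adherent e0 supA.
  have xz : x <= z by apply: (sup_upper_bound supA); rewrite /A/= ax xb.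
  have : f x < 0.
    by apply: he; rewrite /= ger0_norm; rewrite -/z in zx; lra.
  by rewrite ltNge fx.
exists z; split => //.
  rewrite az lt_neqAle zb andbT; apply: contraTneq fb => <-.
  by rewrite fz ltxx.
have zb' : z < b.
  rewrite lt_neqAle zb andbT; apply: contraTneq fb => <-.
  by rewrite fz ltxx.
rewrite leNgt; apply/negP => f'z.
have gz0 : 0 < g z by rewrite gz.
have [e /= e0 he] := @cvgr_gt _ _ _ _ _ (g z) cg 0 gz0.
pose x := Num.min (z + e / 2) b.
have zx : z < x by rewrite lt_min zb' andbT; lra.
have xb : x <= b by rewrite ge_min lexx orbT.
have xe : x <= z + e / 2 by rewrite ge_min lexx.
have gx : 0 < g x.
  by apply: he; rewrite /= distrC gtr0_norm; lra.
have := lt_f0 x; rewrite zx xb => /(_ isT).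
have := fg x; rewrite fz subr0 => ->.
by rewrite ltNge mulr_ge0//; lra.
Qed.

Lemma upcrossing (f f' : R -> R) a b : a < b ->
  (forall x : R, a <= x <= b -> is_derive x 1 f (f' x)) -> f a < 0 -> 0 <= f b ->
  exists z, [/\ a < z <= b, f z = 0 & 0 <= f' z].
Proof.
move=> ab df fa fb.
have dg (x : R) : a <= x <= b -> is_derive x 1 (fun y => f (a + b - y)) (- f' (a + b - x)).
  move=> /andP[ax xb].
  have d1 : is_derive x 1 (fun y => a + b - y) (- 1).
    rewrite -[X in is_derive _ _ _ X]add0r; exact: is_deriveB.
  have d2 : is_derive (a + b - x) 1 f (f' (a + b - x)) by apply: df; lra.
  by apply: (is_derive_ext (@is_derive_chain _ f (fun y => a + b - y) x _ _ d2 d1)) => //;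
    rewrite mulrN1.
have [||z [/andP[z1 z2] fz f'z]] := @downcrossing _ _ a b ab dg.
- by rewrite [a + b]addrC addrK.
- by rewrite addrK.
by exists (a + b - z); split; [lra|exact: fz|lra].
Qed.

End Crossings.

(** * Sign changes of the derivative of the logarithmic gap *)

Section TwoPoint.
Context {R : realType}.
Variables (a p : R).
Hypotheses (a1 : 1 < a) (p1 : 1 < p) (p2 : p < 2).
Implicit Types (b rho x y z t : R).

Let a0 : 0 < a := lt_trans ltr01 a1.
Let p0 : 0 < p := lt_trans ltr01 p1.
Let q0 : 0 < 2 - p. Proof. by rewrite subr_gt0. Qed.

Local Notation u := poisson_den.
Local Notation U := (poissonU a).
Local Notation V := (poissonV a).
Local Notation S := pmoment.

(* Up to a positive factor, the derivative of [slope] at z is the difference of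
   the two sides for x = z^2 and k = p - 1. *)
Lemma weighted_ratio_gt x (k : R) : 0 < x < 1 -> 0 < k < 1 ->
  (1 + k + (1 - k) * x) * x `^ k < 1 - k + (1 + k) * x.
Proof.
move=> /andP[x0 x1] /andP[k0 k1].
(* [h] is the logarithm of the right side over the left. It vanishes at 1 and decreases on ]0, 1[,
   its derivative being a negative multiple of (1 - y)^2. *)
pose h y := ln (1 - k + (1 + k) * y) - ln (1 + k + (1 - k) * y) - k * ln y.
pose h' y := (1 + k) / (1 - k + (1 + k) * y) - (1 - k) / (1 + k + (1 - k) * y) - k / y.
have N1 y : 0 < y -> 0 < 1 - k + (1 + k) * y.
  by move=> y0; rewrite addr_gt0 ?mulr_gt0//; lra.
have N2 y : 0 < y -> 0 < 1 + k + (1 - k) * y.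
  by move=> y0; rewrite addr_gt0 ?mulr_gt0//; lra.
have daff (c d y : R) : is_derive y 1 (fun y => c + d * y) d.
  have H := is_deriveD (is_derive_cst c y 1) (is_deriveZ d (is_derive_id y (1:R))).
  by apply: (is_derive_ext H) => //; rewrite add0r /GRing.scale/= mulr1.
have dh (y : R) : 0 < y -> is_derive y 1 h (h' y).
  move=> y0.
  have H1 := @is_derive_chain _ _ (fun y => 1 - k + (1 + k) * y) y _ _ (is_derive1_ln (N1 y
    y0)) (daff _ _ _).
  have H2 := @is_derive_chain _ _ (fun y => 1 + k + (1 - k) * y) y _ _ (is_derive1_ln (N2 y
    y0)) (daff _ _ _).
  have H := is_deriveB (is_deriveB H1 H2) (is_deriveZ k (is_derive1_ln y0)).
  by apply: (is_derive_ext H) => //; rewrite /h' /GRing.scale/=; ring.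
have hx : 0 < h x.
  have [v|v|c] := @MVT _ h h' x 1 x1.
  - by rewrite in_itv/= => /andP[? ?]; apply: dh; lra.
  - apply: derivable_within_continuous => w; rewrite in_itv/= => /andP[? ?].
    by have [] := dh w ltac:(lra).
  rewrite in_itv/= => /andP[cx c1].
  have -> : h 1 = 0.
    have E1 : 1 + k + (1 - k) = 1 + 1 by ring.
    have E2 : 1 - k + (1 + k) = 1 + 1 by ring.
    by rewrite /h ln1 !mulr1 mulr0 subr0 E1 E2 subrr.
  rewrite sub0r => /eqP; rewrite eqr_oppLR => /eqP ->.
  have c0 : 0 < c by lra.
  have -> : h' c = - (k * (1 - k) * (1 + k) * (1 - c) ^+ 2 / (c * (1 - k + (1 + k) * c) * (1
    + k + (1 - k) * c))).
    by rewrite /h'; field; rewrite !gt_eqF ?N1 ?N2.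
  rewrite mulNr opprK mulr_gt0//; last by lra.
  by rewrite divr_gt0 ?mulr_gt0 ?exprn_gt0 ?N1 ?N2//; lra.
rewrite -ltr_ln ?posrE ?mulr_gt0 ?N1 ?N2 ?powR_gt0//.
rewrite lnM ?posrE ?N2 ?powR_gt0// ln_powR.
by move: hx; rewrite /h; lra.
Qed.

Definition slope z := (z `^ (2 - p) - z `^ p) / (1 - z ^+ 2).

Lemma slope_lt x y : 0 < x -> x < y -> y < 1 -> slope x < slope y.
Proof.
move=> x0 xy y1.
pose s' z := ((2 - p) * z `^ (1 - p) - p * z `^ (p - 1)) / (1 - z ^+ 2) +
   2 * z * (z `^ (2 - p) - z `^ p) / (1 - z ^+ 2) ^+ 2.
have z2 z : 0 < z < 1 -> 0 < 1 - z ^+ 2.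
  by move=> /andP[z0 z1]; rewrite subr_gt0 expr_lt1// ltW.
have ds z : 0 < z < 1 -> is_derive z 1 slope (s' z).
  move=> z01; have /andP[z0 z1] := z01.
  have H1 := is_deriveB (is_derive_powR (2 - p) z0) (is_derive_powR p z0).
  have H2 : is_derive z 1 (fun z => 1 - z ^+ 2) (- (2 * z)).
    have H := is_deriveB (is_derive_cst (1:R) z 1) (is_deriveM (is_derive_id z (1:R))
      (is_derive_id z (1:R))).
    by apply: (is_derive_ext H) => [w|]; [rewrite !fctE expr2|rewrite /GRing.scale/=; ring].
  have H3 := @is_derive_div _ _ (fun z => 1 - z ^+ 2) z _ _ (lt0r_neq0 (z2 z z01)) H1 H2.
  apply: (is_derive_ext H3) => [w|]; first by rewrite !fctE.
  have Ep : 1 - p = 2 - p - 1 by ring.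
  have n0 := lt0r_neq0 (z2 z z01).
  by rewrite /s' Ep !fctE; field.
have s'0 z : 0 < z < 1 -> 0 < s' z.
  move=> z01; have /andP[z0 z1] := z01; have d0 := z2 z z01.
  have p01 : 0 < p - 1 < 1 by rewrite subr_gt0 p1 ltrBlDr.
  have := @weighted_ratio_gt (z ^+ 2) (p - 1) _ p01.
  rewrite exprn_gt0//= expr_lt1 ?ltW// => /(_ z1).
  have -> : (z ^+ 2) `^ (p - 1) = z `^ (p - 1) * z `^ (p - 1).
    by rewrite expr2 powRM ?ltW.
  move=> key.
  have E1 : z `^ (1 - p) = (z `^ (p - 1))^-1 by rewrite -powRN opprB.
  have E2 : z `^ (2 - p) = z * (z `^ (p - 1))^-1.
    rewrite -E1 -{2}(powRr1 (ltW z0)) -powRD; last by rewrite (gt_eqF z0) implybT.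
    by congr (_ `^ _); ring.
  have E3 : z `^ p = z * z `^ (p - 1).
    by rewrite mulr_powRB1 ?ltW.
  have w0 : 0 < z `^ (p - 1) by exact: powR_gt0.
  rewrite /s' E1 E2 E3; move: (z `^ (p - 1)) w0 key => w w0 key.
  have -> : ((2 - p) / w - p * w) / (1 - z ^+ 2) + 2 * z * (z / w - z * w) / (1 - z ^+ 2) ^+ 2
     = ((2 - p) + p * z ^+ 2 - (p + (2 - p) * z ^+ 2) * (w * w)) / (w * (1 - z ^+ 2) ^+ 2).
    by field; rewrite !gt_eqF.
  rewrite divr_gt0 ?mulr_gt0 ?exprn_gt0//.
  move: key; have -> : 1 + (p - 1) = p by ring.
  have -> : 1 - (p - 1) = 2 - p by ring.
  by lra.
have [v|v|c] := @MVT _ slope s' x y xy.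
- by rewrite in_itv/= => /andP[? ?]; apply: ds; lra.
- apply: derivable_within_continuous => w; rewrite in_itv/= => /andP[? ?].
  by have [] := ds w ltac:(lra).
rewrite in_itv/= => /andP[? ?] E; rewrite -subr_gt0 E mulr_gt0//; last by lra.
by apply: s'0; lra.
Qed.

Local Notation M := (S a 0).

Lemma pmoment00 b : S b 0 0 = 1.
Proof.
rewrite -[RHS](@cmean_cst R 1); apply: eq_cmean => t.
by rewrite /poisson_den expr0n mulr0 mul0r !addr0 powR1 mul1r expr0.
Qed.

Lemma cmean_poisson_gt0 b (g : R -> R) rho e : -1 < rho < 1 -> continuous g ->
  0 < e -> (forall t, e <= g t) -> 0 < cmean (fun t => u rho t `^ b * g t).
Proof.
move=> r1 cg e0 eg.
pose s := `|rho|; have s1 : s < 1 by rewrite ltr_norml.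
have s0 : 0 <= s by exact: normr_ge0.
have rs : - s <= rho <= s by rewrite -ler_norml.
(* The power increases or decreases according to the sign of b, so the smaller of its two endpoint
   values is a lower bound in both cases. *)
pose m := Num.min (((1 - s) ^+ 2) `^ b) (4 `^ b) * e.
have s2 : 0 < (1 - s) ^+ 2 by rewrite exprn_gt0// subr_gt0.
have m0 : 0 < m by rewrite mulr_gt0// lt_min !powR_gt0.
apply: (lt_le_trans m0); apply: cmean_ge => [|t].
  apply: (@continuous_poisson_phi _ (fun x => x `^ b)) => // y.
  exact: continuous_powR.
have /andP[u1 u2] := poisson_den_bound t rs (ltW s1).
have u0 : 0 < u rho t by exact: lt_le_trans u1.
apply: ler_pM => //; first by rewrite le_min !powR_ge0.
  exact: ltW.
rewrite ge_min; have [b0|b0] := leP 0 b.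
  by rewrite ge0_ler_powR// nnegrE ltW.
rewrite -[b]opprK !(powRN _ (- b)) [X in _ || X]lef_pV2 ?posrE ?powR_gt0//.
by rewrite [X in _ || X]ge0_ler_powR ?orbT// ?nnegrE ?ltW// oppr_gt0.
Qed.

Lemma pmoment0_gt0 b rho : -1 < rho < 1 -> 0 < S b 0 rho.
Proof.
move=> r1; apply: (@cmean_poisson_gt0 b _ rho 1) => // t.
exact: cvg_cst.
Qed.

Lemma poissonU_gt0 rho : -1 < rho < 1 -> 0 < U rho.
Proof.
move=> r1.
have -> : U rho = cmean (fun t => u rho t `^ (a - 1) * (1 + rho * cosT t)).
  rewrite /poissonU /S -cmeanZ; last exact: continuous_pmoment_fun.
  rewrite -cmeanD; last 2 first.
  - exact: continuous_pmoment_fun.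
  - by move=> t; apply: cvgM; [exact: cvg_cst|exact: continuous_pmoment_fun].
  by apply: eq_cmean => t; rewrite expr0 expr1; ring.
have s1 : `|rho| < 1 by rewrite ltr_norml.
apply: (@cmean_poisson_gt0 _ _ rho (1 - `|rho|)) => //.
- move=> t; apply: cvgD; first exact: cvg_cst.
  by apply: cvgM; [exact: cvg_cst|exact: continuous_cosT].
- by rewrite subr_gt0.
- move=> t; have : `|rho * cosT t| <= `|rho|.
    by rewrite normrM ler_piMr// cos_max.
  by rewrite ler_norml => /andP[+ _]; lra.
Qed.

(** The interval has rho = 1 in its interior: this is how facts proved for rho < 1 reach the
    endpoint, where the denominator vanishes at t = 1/2. The dominating constant 16^b is crude, the
    denominator being below 9 here. *)
Lemma continuous_pmoment b j rho : 0 <= b -> -2 < rho < 2 ->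
  {for rho, continuous (S b j)}.
Proof.
move=> b0 r2.
have cu x : continuous (fun t => u x t `^ b * cosT t ^+ j).
  move=> t; apply: cvgM; last exact: continuous_cosTX.
  apply: continuous_comp_powR; [exact: b0|exact: continuous_poisson_den|].
  exact: poisson_den_ge0.
have H := @continuity_under_integral R _ _ (@lebesgue_measure R)
  (fun rho t => u rho t `^ b * cosT t ^+ j) `[0, 1] _ (- 2) 2 _ _ (fun=> 16 `^ b).
apply: H => //.
- by move=> x _; apply: integrable_unit.
- apply: aeW => t _ x _; apply: cvgM; last exact: cvg_cst.
  apply: (@continuous_comp_powR _ (u ^~ t)); first exact: b0.
  + by move=> y; exact: is_derive_continuous (is_derive_poisson_den1 y t).
  + by move=> y; exact: poisson_den_ge0.
- by apply: integrable_unit => t; exact: cvg_cst.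
- move=> x; rewrite /= in_itv/= => /andP[x1 x2]; apply: aeW => t _.
  rewrite normrM ger0_norm ?powR_ge0// normrX -[leRHS]mulr1; apply: ler_pM => //.
  + exact: powR_ge0.
  + apply: ge0_ler_powR => //.
    * by rewrite nnegrE poisson_den_ge0.
    * by rewrite nnegrE.
    * by have /andP[? ?] := cosT_bound t; rewrite /poisson_den; nra.
  + by rewrite exprn_ile1// cos_max.
- by rewrite inE/= in_itv.
Qed.

(** Up to a positive factor this is the derivative of the logarithmic gap [gapD]: the terms rho^p V
    cancel because M = U + V. *)
Definition gapK rho := rho `^ p * U rho - V rho.
Definition gapK' rho := p * rho `^ (p - 1) * U rho +
  rho `^ p * (2 * a * S (a - 1) 1 rho) - 2 * a * rho * S (a - 1) 0 rho.

Lemma is_derive_gapK rho : 0 < rho < 1 -> is_derive rho 1 gapK (gapK' rho).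
Proof.
move=> /andP[r0 r1]; have r2 : -1 < rho < 1 by lra.
have H := is_deriveB (is_deriveM (is_derive_powR p r0) (is_derive_poissonU a r2))
  (is_derive_poissonV a r2).
by apply: (is_derive_ext H) => //; rewrite /gapK' /GRing.scale/=; ring.
Qed.

(** At a zero V = rho^p U. Once the moments of exponent a - 1 are expressed through U and V,
    everything is a multiple of U, which is positive. *)
Lemma gapK'_root rho : 0 < rho < 1 -> gapK rho = 0 ->
  gapK' rho * rho = rho `^ p * U rho * (p - 2 * a * slope rho).
Proof.
move=> /andP[r0 r1] /eqP; rewrite /gapK subr_eq0 => /eqP E.
have d0 : 1 - rho ^+ 2 != 0 by rewrite gt_eqF// subr_gt0 expr_lt1// ltW.
have E0 : (1 - rho ^+ 2) * S (a - 1) 0 rho = U rho - V rho.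
  by rewrite /poissonU /poissonV; ring.
have E1 : (1 - rho ^+ 2) * (rho * S (a - 1) 1 rho) = V rho - rho ^+ 2 * U rho.
  by rewrite /poissonU /poissonV; ring.
have E2 : rho `^ p * rho `^ (2 - p) = rho ^+ 2.
  rewrite -powRD; last by rewrite (gt_eqF r0) implybT.
  by rewrite addrC subrK powR_mulrn// ltW.
have E3 : rho * rho `^ (p - 1) = rho `^ p by rewrite mulr_powRB1 ?ltW.
apply: (mulfI d0).
have -> : (1 - rho ^+ 2) * (gapK' rho * rho) = (1 - rho ^+ 2) * p * (rho * rho `^ (p - 1)) * U rho
   + 2 * a * rho `^ p * ((1 - rho ^+ 2) * (rho * S (a - 1) 1 rho))
   - 2 * a * rho ^+ 2 * ((1 - rho ^+ 2) * S (a - 1) 0 rho).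
  by rewrite /gapK'; ring.
rewrite E0 E1 E3 -E.
have -> : (1 - rho ^+ 2) * (rho `^ p * U rho * (p - 2 * a * slope rho)) =
  U rho * ((1 - rho ^+ 2) * p * rho `^ p - 2 * a * (rho `^ p * rho `^ (2 - p) - rho `^ p *
    rho `^ p)).
  by rewrite /slope; field.
by rewrite E2; ring.
Qed.

(* At a zero of gapK the sign of its derivative is that of p - 2 a slope; as
   slope increases, an upcrossing cannot follow a downcrossing. *)
Lemma gapK_no_dip x y z : 0 < x -> x < y -> y < z -> z < 1 ->
  0 <= gapK x -> gapK y < 0 -> gapK z < 0.
Proof.
move=> x0 xy yz z1.
have dK1 w : x <= w <= y -> is_derive w 1 gapK (gapK' w).
  by move=> /andP[? ?]; apply: is_derive_gapK; lra.
have dK2 w : y <= w <= z -> is_derive w 1 gapK (gapK' w).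
  by move=> /andP[? ?]; apply: is_derive_gapK; lra.
move=> Kx Ky; rewrite ltNge; apply/negP => Kz.
have [v [/andP[xv vy] Kv K'v]] := downcrossing xy dK1 Kx Ky.
have [w [/andP[yw wz] Kw K'w]] := upcrossing yz dK2 Ky Kz.
have v0 : 0 < v by exact: lt_le_trans xv.
have w1 : w < 1 by exact: le_lt_trans z1.
have vw : v < w by exact: lt_trans yw.
have v01 : 0 < v < 1 by rewrite v0 (lt_trans vw).
have w01 : 0 < w < 1 by rewrite (lt_trans v0 vw).
have Ev := gapK'_root v01 Kv.
have Ew := gapK'_root w01 Kw.
have pos t : 0 < t < 1 -> 0 < t `^ p * U t.
  move=> /andP[t0 t1]; rewrite mulr_gt0 ?powR_gt0 ?poissonU_gt0//.
  by rewrite t1 (lt_trans _ t0)// ltrN10.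
have h1 : p - 2 * a * slope v <= 0.
  by rewrite -(pmulr_rle0 _ (pos v v01)) -Ev mulr_le0_ge0// ltW.
have h2 : 0 <= p - 2 * a * slope w.
  rewrite -(pmulr_rge0 _ (pos w w01)) -Ew mulr_ge0//.
  by case/andP: w01 => /ltW.
have := slope_lt v0 vw w1.
have a20 : 0 < 2 * a by rewrite mulr_gt0.
rewrite -(ltr_pM2l a20) ltNge => /negP; apply.
by rewrite (@le_trans _ _ p)//; [rewrite -subr_ge0|rewrite -subr_le0].
Qed.

(** Integration by parts shows V = x^2 W with W continuous at 0, so gapK x = x^p (U - x^(2-p) W). As
    p < 2, the bracket tends to U 0 > 0. *)
Lemma gapK_near0 e : 0 < e -> exists2 x, 0 < x < e & 0 < gapK x.
Proof.
move=> e0.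
pose W x := S (a - 1) 0 x + 2 * (a - 1) * (S (a - 1 - 1) 0 x - S (a - 1 - 1) 2 x).
pose k x := U x - `|x| `^ (2 - p) * W x.
have c0 b j : {for 0, continuous (S b j)}.
  by apply: (is_derive_continuous (is_derive_pmoment b j _)); rewrite ltrN10 ltr01.
have cU : {for 0, continuous U}.
  by apply: (is_derive_continuous (is_derive_poissonU a _)); rewrite ltrN10 ltr01.
have ck : {for 0, continuous k}.
  apply: cvgB; first exact: cU.
  apply: cvgM; first by apply: continuous_norm_powR; exact: ltW.
  apply: cvgD; first exact: c0.
  by apply: cvgM; [exact: cvg_cst|apply: cvgB; exact: c0].
have k0 : 0 < k 0.
  rewrite /k normr0 powR0 ?mul0r ?subr0; last by rewrite gt_eqF.
  by apply: poissonU_gt0; rewrite ltrN10 ltr01.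
have [d /= d0 hd] := @cvgr_gt _ _ _ _ _ (k 0) ck 0 k0.
pose x := Num.min (Num.min (e / 2) (d / 2)) (1 / 2).
have x0 : 0 < x by rewrite !lt_min; apply/andP; split; [apply/andP; split|]; lra.
have xe : x <= e / 2 by rewrite !ge_min lexx.
have xd : x <= d / 2 by rewrite !ge_min lexx orbT.
have x1 : x <= 1 / 2 by rewrite !ge_min lexx !orbT.
exists x; first lra.
have : 0 < k x by apply: hd; rewrite /= sub0r normrN gtr0_norm; lra.
rewrite /k gtr0_norm// => kx.
have xx1 : -1 < x < 1 by lra.
have E2 : x `^ p * x `^ (2 - p) = x ^+ 2.
  rewrite -powRD; last by rewrite (gt_eqF x0) implybT.
  by rewrite addrC subrK powR_mulrn// ltW.
have -> : gapK x = x `^ p * (U x - x `^ (2 - p) * W x).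
  rewrite mulrBr mulrA E2 /gapK; congr (_ - _).
  by rewrite /poissonV /W (pmoment_by_parts (a - 1) xx1); ring.
by rewrite mulr_gt0// powR_gt0.
Qed.

End TwoPoint.

(** * Tangent-line bounds for powers *)

Section PowerBounds.
Context {R : realType}.
Implicit Types (a s x y t : R).

(** Bernoulli's inequality, read off from Young's inequality for the product of t and 1 with
    exponents a and a / (a - 1). *)
Lemma powR_tangent1 a t : 1 <= a -> 0 <= t -> 1 + a * (t - 1) <= t `^ a.
Proof.
rewrite le_eqVlt => /predU1P[<- t0|a1 t0]; first by rewrite powRr1//; lra.
have a0 : 0 < a by exact: lt_trans a1.
have q0 : 0 < a / (a - 1) by rewrite divr_gt0// subr_gt0.
have E : a^-1 + (a / (a - 1))^-1 = 1.
  by rewrite invf_div; field; rewrite gt_eqF// subr_gt0 a1 gt_eqF.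
have := @conjugate_powR _ t 1 a (a / (a - 1)) t0 ler01 a0 q0 E.
rewrite mulr1 powR1 mul1r invf_div -(ler_pM2l a0).
have -> : a * (t `^ a / a + (a - 1) / a) = t `^ a + (a - 1).
  by field; rewrite gt_eqF.
by lra.
Qed.

Lemma powR_tangent a x y : 1 < a -> 0 <= x -> 0 <= y ->
  y `^ a + a * y `^ (a - 1) * (x - y) <= x `^ a.
Proof.
move=> a1 x0; have a0 : 0 < a by exact: lt_trans a1.
rewrite le_eqVlt => /predU1P[<-|y0].
  rewrite !powR0 ?gt_eqF ?subr_gt0// mulr0 mul0r addr0; exact: powR_ge0.
have xy0 : 0 <= x / y by rewrite divr_ge0// ltW.
have := powR_tangent1 (ltW a1) xy0.
rewrite -(ler_pM2l (powR_gt0 a y0)) -powRM//; last exact: ltW.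
rewrite mulrCA divff ?gt_eqF// mulr1; apply: le_trans.
rewrite le_eqVlt; apply/orP; left; apply/eqP.
by rewrite -(mulr_powRB1 (ltW y0) a0); field; rewrite gt_eqF.
Qed.

(** This is [powR_tangent1] for the exponent 1 / s at the point t^s. *)
Lemma powR_bernoulli s t : 0 <= s <= 1 -> 0 <= t -> t `^ s <= 1 + s * (t - 1).
Proof.
move=> /andP[]; rewrite le_eqVlt => /predU1P[<- _ _|s0 s1 t0].
  by rewrite powRr0 mul0r addr0.
have := @powR_tangent1 s^-1 (t `^ s) _ (powR_ge0 _ _).
rewrite invf_ge1// => /(_ s1).
rewrite -powRrM divff ?gt_eqF// powRr1// -(ler_pM2l s0).
have -> : s * (1 + s^-1 * (t `^ s - 1)) = s + (t `^ s - 1) by field; rewrite gt_eqF.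
by lra.
Qed.

Lemma cmean_cosT : cmean (@cosT R) = 0.
Proof.
have tp : 2 * pi != 0 :> R by rewrite gt_eqF// mulr_gt0// pi_gt0.
have dF (t : R) : is_derive t 1 (fun t => (2 * pi)^-1 * sinT t) (cosT t).
  apply: (is_derive_ext (is_deriveZ (2 * pi)^-1 (is_derive_sinT t))) => //.
  by rewrite /GRing.scale/= mulKf.
by rewrite (cmean_FTC (@continuous_cosT R) dF) sinT0 sinT1 subrr.
Qed.

End PowerBounds.

(** * The linear two-point inequality *)

Section TwoPointInequality.
Context {R : realType}.
Variables (a p : R).
Hypotheses (a1 : 1 < a) (p1 : 1 < p) (p2 : p < 2).
Implicit Types (rho x y z t : R).
Local Notation u := poisson_den.
Local Notation U := (poissonU a).
Local Notation V := (poissonV a).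
Local Notation S := pmoment.
Local Notation M := (S a 0).
Local Notation gapK := (gapK a p).

Let a0 : 0 < a := lt_trans ltr01 a1.
Let p0 : 0 < p := lt_trans ltr01 p1.

Lemma continuous_poisson_powR rho : continuous (fun t => u rho t `^ a).
Proof.
apply: continuous_comp_powR; first exact: ltW.
  exact: continuous_poisson_den.
by move=> t; exact: poisson_den_ge0.
Qed.

(** At rho = 1 the integrand has no positive lower bound; instead, the tangent of y^a at y = 1 has
    mean 1 + a. *)
Lemma pmoment0_1_gt0 : 0 < M 1.
Proof.
have cu := @continuous_poisson_den R 1.
have cau : continuous (fun t => a * (u 1 t - 1)).
  by move=> t; apply: cvgM; [exact: cvg_cst|apply: cvgB; [exact: cu|exact: cvg_cst]].
have caff : continuous (fun t => 1 + a * (u 1 t - 1)).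
  by move=> t; apply: cvgD; [exact: cvg_cst|exact: cau].
have -> : M 1 = cmean (fun t => u 1 t `^ a).
  by apply: eq_cmean => t; rewrite expr0 mulr1.
have a10 : 0 < 1 + a by rewrite addr_gt0.
apply: (lt_le_trans a10).
have -> : 1 + a = cmean (fun t => (1 + a) + 2 * a * cosT t).
  have cc : continuous (fun t => 2 * a * cosT t).
    by move=> t; apply: cvgM; [exact: cvg_cst|exact: continuous_cosT].
  rewrite (@cmeanD _ (fun=> 1 + a) (fun t => 2 * a * cosT t))//; last by move=> ?; exact: cvg_cst.
  by rewrite cmean_cst cmeanZ ?cmean_cosT ?mulr0 ?addr0//; exact: continuous_cosT.
apply: le_cmean.
- move=> t; apply: cvgD; first exact: cvg_cst.
  by apply: cvgM; [exact: cvg_cst|exact: continuous_cosT].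
- exact: continuous_poisson_powR.
- move=> t; apply: le_trans (powR_tangent1 (ltW a1) (poisson_den_ge0 1 t)).
  by rewrite /poisson_den; lra.
Qed.

Lemma is_derive_pmoment0 rho : -1 < rho < 1 -> rho != 0 ->
  is_derive rho 1 M (2 * a * V rho / rho).
Proof.
move=> r1 r0; apply: (is_derive_ext (is_derive_pmoment a 0 r1)) => //.
by rewrite /poissonV; field.
Qed.

Definition gapD rho := p^-1 * ln (1 + rho `^ p) - (2 * a)^-1 * ln (M rho).

Lemma is_derive_gapD rho : 0 < rho < 1 ->
  is_derive rho 1 gapD (gapK rho / (rho * (1 + rho `^ p) * M rho)).
Proof.
move=> /andP[r0 r1].
have r2 : -1 < rho < 1 by rewrite r1 (lt_trans _ r0)// ltrN10.
have M0 : 0 < M rho by exact: pmoment0_gt0.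
have y0 : 0 < 1 + rho `^ p by rewrite addr_gt0// powR_gt0.
have d1 : is_derive rho 1 (fun x => 1 + x `^ p) (p * rho `^ (p - 1)).
  apply: (is_derive_ext (is_deriveD (is_derive_cst (1:R) rho 1) (is_derive_powR p r0))) => //.
  by rewrite add0r.
have H1 := @is_derive_chain _ _ (fun x => 1 + x `^ p) rho _ _ (is_derive1_ln y0) d1.
have H2 := @is_derive_chain _ _ M rho _ _ (is_derive1_ln M0) (is_derive_pmoment0 r2 (lt0r_neq0 r0)).
have H := is_deriveB (is_deriveZ p^-1 H1) (is_deriveZ (2 * a)^-1 H2).
apply: (is_derive_ext H) => //; rewrite /GRing.scale/=.
have E3 : rho `^ p = rho * rho `^ (p - 1) by rewrite mulr_powRB1 ?ltW.
rewrite /gapK E3 in y0 *.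
have EM := pmoment0E a r2; rewrite EM in M0 *.
move: (rho `^ (p - 1)) y0 => w y0; move: (U rho) (V rho) M0 => v1 v2 M0.
by field; rewrite !gt_eqF.
Qed.

Lemma continuous_gapD : {within `[0, 1], continuous gapD}.
Proof.
(* This agrees with [gapD] on [0, 1] and is two-sidedly continuous at 0 thanks to the absolute
   value. *)
pose D x := p^-1 * ln (1 + `|x| `^ p) - (2 * a)^-1 * ln (M x).
have ED : {in `[0, 1]%classic, D =1 gapD}.
  by move=> x; rewrite inE/= in_itv/= => /andP[x0 _]; rewrite /D ger0_norm.
apply: (subspace_eq_continuous ED).
apply: continuous_in_subspaceT => x; rewrite inE/= in_itv/= => /andP[x0 x1].
have M0 : 0 < M x.
  move: x1; rewrite le_eqVlt => /predU1P[->|x1]; first exact: pmoment0_1_gt0.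
  by apply: pmoment0_gt0; rewrite x1 (lt_le_trans _ x0)// ltrN10.
apply: cvgB; (apply: cvgM; first exact: cvg_cst).
- apply: (@continuous_comp _ _ _ (fun x => 1 + `|x| `^ p) (@ln R)).
    by apply: cvgD; [exact: cvg_cst|apply: continuous_norm_powR; exact: ltW].
  by apply: continuous_ln; rewrite ltr_wpDr ?powR_ge0.
- apply: (@continuous_comp _ _ _ M (@ln R)); last exact: continuous_ln.
  apply: continuous_pmoment; [exact: ltW|lra].
Qed.

(** If the gap were negative at rho, the mean value theorem on [0, rho] and on [rho, 1] would give
    points x1 < x2 with gapK x1 < 0 <= gapK x2; since gapK is positive near 0, [gapK_no_dip] forbids
    this. *)
Lemma gapD_ge0 rho : 0 <= gapD 1 -> 0 <= rho <= 1 -> 0 <= gapD rho.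
Proof.
move=> D1 /andP[r0 r1].
have D0 : gapD 0 = 0.
  by rewrite /gapD pmoment00 powR0 ?gt_eqF// addr0 ln1 !mulr0 subrr.
move: r0; rewrite le_eqVlt => /predU1P[<-|r0]; first by rewrite D0.
move: r1; rewrite le_eqVlt => /predU1P[->//|r1].
rewrite leNgt; apply/negP => Dr.
have denom x : 0 < x -> x < 1 -> 0 < (x * (1 + x `^ p) * M x)^-1.
  move=> x0 x1; rewrite invr_gt0 !mulr_gt0// ?addr_gt0 ?powR_gt0//.
  by apply: pmoment0_gt0; rewrite x1 (lt_trans _ x0)// ltrN10.
have cD x y : 0 <= x -> y <= 1 -> {within `[x, y], continuous gapD}.
  move=> x0 y1; apply: continuous_subspaceW continuous_gapD.
  by apply: subset_itv; rewrite bnd_simp.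
pose D' x := gapK x / (x * (1 + x `^ p) * M x).
have [v|x1 x1I E1] := @MVT _ gapD D' 0 rho r0 _ (cD _ _ (lexx _) (ltW r1)).
  by rewrite in_itv/= => /andP[v0 v1]; apply: is_derive_gapD; rewrite v0 (lt_trans v1).
have [v|x2 x2I E2] := @MVT _ gapD D' rho 1 r1 _ (cD _ _ (ltW r0) (lexx _)).
  by rewrite in_itv/= => /andP[v0 v1]; apply: is_derive_gapD; rewrite v1 (lt_trans r0).
move: x1I x2I; rewrite !in_itv/= => /andP[x10 x1r] /andP[x2r x21].
have K1 : gapK x1 < 0.
  rewrite -(pmulr_llt0 _ (denom x1 x10 (lt_trans x1r r1))).
  by rewrite -(pmulr_llt0 _ r0) -[X in _ * X](subr0 rho) -E1 D0 subr0.
have K2 : 0 <= gapK x2.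
  rewrite -(pmulr_lge0 _ (denom x2 (lt_trans r0 x2r) x21)).
  have r10 : 0 < 1 - rho by rewrite subr_gt0.
  rewrite -(pmulr_lge0 _ r10) -E2 subr_ge0 (le_trans _ D1)// ltW//.
have [x0 /andP[x00 x01] K0] := @gapK_near0 R a p p2 x1 x10.

have := @gapK_no_dip _ a p a1 p1 p2 x0 x1 x2 x00 x01 (lt_trans x1r x2r) x21 (ltW K0) K1.
by rewrite ltNge K2.
Qed.

(** The hypothesis is the case x = y = 1 and says that [gapD 1] is nonnegative. Symmetry and
    homogeneity of degree 2 a reduce the claim to x = 1 and y = rho <= 1. *)
Theorem two_point x y : cmean (fun t => (2 + 2 * cosT t) `^ a) <= 2 `^ (2 * a / p) ->
  0 <= x -> 0 <= y ->
  cmean (fun t => (x ^+ 2 + y ^+ 2 + 2 * x * y * cosT t) `^ a) <=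
  (x `^ p + y `^ p) `^ (2 * a / p).
Proof.
move=> h1; wlog xy : x y / y <= x => [hw x0 y0|x0 y0].
  have [xy|xy] := leP y x; first exact: hw.
  rewrite [_ + y `^ p]addrC; apply: le_trans (hw _ _ (ltW xy) y0 x0).
  rewrite le_eqVlt; apply/orP; left; apply/eqP.
  by apply: eq_cmean => t; congr (_ `^ _); ring.
have D1 : 0 <= gapD 1.
  rewrite /gapD subr_ge0 powR1.
  have M1 := pmoment0_1_gt0.
  have : M 1 <= 2 `^ (2 * a / p).
    apply: le_trans h1; rewrite le_eqVlt; apply/orP; left; apply/eqP.
    by apply: eq_cmean => t; rewrite expr0 mulr1 /poisson_den; congr (_ `^ _); ring.
  rewrite -ler_ln ?posrE ?powR_gt0// ln_powR => h.
  have a20 : 0 < 2 * a by rewrite mulr_gt0.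
  rewrite mulrC ler_pdivrMr//; apply: (le_trans h).
  by rewrite le_eqVlt; apply/orP; left; apply/eqP; have -> : 1 + 1 = 2 :> R by []; field;
    rewrite gt_eqF.
move: x0; rewrite le_eqVlt => /predU1P[x0|x0].
  have -> : y = 0 by apply/le_anti; rewrite y0 andbT x0.
  rewrite -x0 !powR0 ?gt_eqF// addr0.
  rewrite (@eq_cmean _ _ (fun=> 0)) ?cmean_cst ?powR_ge0// => t.
  by rewrite expr0n !mulr0 mul0r !addr0 powR0// gt_eqF.
pose r := y / x.
have r0 : 0 <= r by rewrite divr_ge0// ltW.
have r1 : r <= 1 by rewrite ler_pdivrMr// mul1r.
have yE : y = x * r by rewrite mulrC divfK// gt_eqF.
have M0 : 0 < M r.
  move: r1; rewrite le_eqVlt => /predU1P[->|r1]; first exact: pmoment0_1_gt0.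
  by apply: pmoment0_gt0; rewrite r1 (lt_le_trans _ r0)// ltrN10.
have key : M r <= (1 + r `^ p) `^ (2 * a / p).
  have pr0 : 0 < 1 + r `^ p by rewrite ltr_wpDr ?powR_ge0.
  rewrite -ler_ln ?posrE ?powR_gt0// ln_powR.
  have : 0 <= gapD r by apply: gapD_ge0 => //; rewrite r0.
  rewrite /gapD subr_ge0 mulrC ler_pdivrMr ?mulr_gt0// => h.
  by apply: (le_trans h); rewrite le_eqVlt; apply/orP; left; apply/eqP; ring.
have -> : cmean (fun t => (x ^+ 2 + y ^+ 2 + 2 * x * y * cosT t) `^ a) = (x ^+ 2) `^ a * M r.
  rewrite /S -cmeanZ; last first.
    move=> t; apply: cvgM; first exact: continuous_poisson_powR.
    exact: continuous_cosTX.
  apply: eq_cmean => t; rewrite expr0 mulr1 -powRM ?sqr_ge0 ?poisson_den_ge0//.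
  by congr (_ `^ _); rewrite yE /poisson_den; ring.
have -> : x `^ p + y `^ p = x `^ p * (1 + r `^ p).
  by rewrite yE powRM ?(ltW x0)//; ring.
rewrite powRM ?powR_ge0 ?addr_ge0 ?powR_ge0//.
have -> : (x `^ p) `^ (2 * a / p) = (x ^+ 2) `^ a.
  rewrite -powRrM -powR_mulrn ?(ltW x0)// -powRrM; congr (_ `^ _).
  by field; rewrite gt_eqF.
by rewrite ler_pM2l ?powR_gt0 ?exprn_gt0.
Qed.

End TwoPointInequality.

(** * The nonlinear two-point inequality *)

Section NonlinearComparison.
Context {R : realType}.
Implicit Types (a x y v w X Y : R).
Local Notation u := poisson_den.

(** Bernoulli's inequality for the power w / v of exp v; it expresses that v / (exp v - 1)
    decreases. *)
Lemma expR_chord v w : 0 < v -> v <= w -> w * (expR v - 1) <= v * (expR w - 1).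
Proof.
move=> v0 vw.
have := @powR_tangent1 _ (w / v) (expR v) _ (expR_ge0 v).
rewrite ler_pdivlMr// mul1r => /(_ vw).
rewrite /powR gt_eqF ?expR_gt0// expRK divfK ?gt_eqF// -(ler_pM2l v0) mulrDr mulr1.
rewrite mulrA mulrCA divff ?gt_eqF// mulr1; lra.
Qed.

(* log (1 - exp (- exp w)) is concave in w, since v / (exp v - 1) decreases. *)
Lemma one_sub_expR_mul_le X Y : 0 <= X -> 0 <= Y ->
  (1 - expR (- X)) * (1 - expR (- Y)) <= (1 - expR (- Num.sqrt (X * Y))) ^+ 2.
Proof.
wlog XY : X Y / Y <= X => [hw X0 Y0|].
  have [XY|XY] := leP Y X; first exact: hw.
  by rewrite mulrC [X * Y]mulrC; apply: hw => //; exact: ltW.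
move=> X0; rewrite le_eqVlt => /predU1P[<-|Y0].
  by rewrite oppr0 expR0 subrr mulr0 sqr_ge0.
have {X0}X0 : 0 < X by exact: lt_le_trans XY.
pose s := Num.sqrt (X * Y).
have s0 : 0 < s by rewrite sqrtr_gt0 mulr_gt0.
have s2 : s ^+ 2 = X * Y by rewrite sqr_sqrtr// mulr_ge0// ltW.
have sX : s <= X.
  by rewrite -ler_sqr ?nnegrE ?(ltW s0) ?(ltW X0)// s2 expr2 ler_pM2l.
(* On the logarithmic scale X and Y lie symmetrically about their geometric mean s. Below, F W is
   the logarithm of the left side and F 0 that of the right side. *)
pose W := ln (X / s).
have Xs : 0 < X / s by rewrite divr_gt0.
have EX : s * expR W = X by rewrite /W lnK ?posrE// mulrC divfK ?gt_eqF.
have EY : s * expR (- W) = Y.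
  apply: (mulfI (lt0r_neq0 X0)); rewrite -s2 -EX expRN.
  by field; rewrite gt_eqF ?expR_gt0.
have W0 : 0 <= W by rewrite ln_ge0// ler_pdivlMr// mul1r.
pose F w := ln (1 - expR (- (s * expR w))) + ln (1 - expR (- (s * expR (- w)))).
pose g v := v * expR (- v) / (1 - expR (- v)).
pose F' w := g (s * expR w) - g (s * expR (- w)).
have e1 v : 0 < v -> 0 < 1 - expR (- v).
  by move=> v0; rewrite subr_gt0 -expR0 ltr_expR oppr_lt0.
have dl v : 0 < v -> is_derive v 1 (fun v => ln (1 - expR (- v))) (expR (- v) / (1 - expR (- v))).
  move=> v0.
  have d1 : is_derive v 1 (fun v => - v) (- 1) by exact: is_deriveN.
  have d2 := @is_derive_chain _ (@expR R) (fun v => - v) v _ _ (is_derive_expR _) d1.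
  have d3 : is_derive v 1 (fun v => 1 - expR (- v)) (expR (- v)).
    by apply: (is_derive_ext (is_deriveB (is_derive_cst (1:R) v 1) d2)) => //; rewrite mulrN1
      sub0r opprK.
  apply: (is_derive_ext (@is_derive_chain _ (@ln R) (fun v => 1 - expR (- v)) v _ _
    (is_derive1_ln (e1 v v0)) d3)) => //.
  by rewrite mulrC.
have dF w : is_derive w 1 F (F' w).
  have d1 : is_derive w 1 (fun w => s * expR w) (s * expR w).
    exact: (is_deriveZ s (is_derive_expR w)).
  have d2 : is_derive w 1 (fun w => s * expR (- w)) (- (s * expR (- w))).
    have dn : is_derive w 1 (fun v => - v) (- 1) by exact: is_deriveN.
    have := @is_derive_chain _ (@expR R) (fun v => - v) w _ _ (is_derive_expR _) dn.
    by move=> /(is_deriveZ s)H; apply: (is_derive_ext H) => //; rewrite /GRing.scale/=; ring.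
  have p1 : 0 < s * expR w by rewrite mulr_gt0 ?expR_gt0.
  have p2 : 0 < s * expR (- w) by rewrite mulr_gt0 ?expR_gt0.
  have H1 := @is_derive_chain _ _ (fun w => s * expR w) w _ _ (dl _ p1) d1.
  have H2 := @is_derive_chain _ _ (fun w => s * expR (- w)) w _ _ (dl _ p2) d2.
  apply: (is_derive_ext (is_deriveD H1 H2)) => //; rewrite /F' /g.
  move: (e1 _ p1) (e1 _ p2); move: (expR (- (s * expR w))) (expR (- (s * expR (- w)))) => x y n1 n2.
  by field; rewrite !gt_eqF.
have gd v w : 0 < v -> v <= w -> g w <= g v.
  move=> v0 vw; have w0 := lt_le_trans v0 vw.
  have gE z : 0 < z -> g z = z / (expR z - 1).
    move=> z0; rewrite /g expRN; have ez : 1 < expR z by rewrite -expR0 ltr_expR.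
    by field; rewrite !gt_eqF ?subr_gt0 ?expR_gt0.
  have ev z : 0 < z -> 0 < expR z - 1 by move=> z0; rewrite subr_gt0 -expR0 ltr_expR.
  rewrite !gE// ler_pdivrMr ?ev// mulrAC ler_pdivlMr ?ev//; exact: expR_chord.
have FW : F W <= F 0.
  have cF : {within `[0, W], continuous F}.
    by apply: continuous_subspaceT => v; exact: is_derive_continuous (dF v).
  have [c] := @MVT_segment _ F F' 0 W W0 (fun v _ => dF v) cF.
  rewrite in_itv/= => /andP[c0 _] E; rewrite -subr_le0 E subr0 mulr_le0_ge0//.
  rewrite subr_le0 gd ?mulr_gt0 ?expR_gt0// ler_pM2l// ler_expR.
  by rewrite (le_trans _ c0)// oppr_le0.
move: FW; rewrite /F EX EY oppr0 expR0 !mulr1 -!lnM ?posrE ?e1//.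
by rewrite ler_ln ?posrE ?mulr_gt0 ?e1// expr2.
Qed.

Lemma ln_le_subr1 x : 0 < x -> ln x <= x - 1.
Proof. by move=> x0; have := @le_ln1Dx _ (x - 1); rewrite subrKC; apply; lra. Qed.

Lemma ln_tangent x y : 0 < x -> 0 < y -> ln y <= ln x + (y - x) / x.
Proof.
move=> x0 y0; have := ln_le_subr1 (divr_gt0 y0 x0).
by rewrite ln_div ?posrE// mulrBl divff ?gt_eqF//; lra.
Qed.

(** * Comparison in convex order by a single crossing *)

Section Comparison.
Variables (a X Y : R).
Hypotheses (a1 : 1 < a) (X0 : 0 <= X) (Y0 : 0 <= Y).

Let rho := Num.sqrt ((1 - expR (- X)) * (1 - expR (- Y))).
Let s := Num.sqrt (X * Y).
Let lu (c : R) := ln (1 + rho ^+ 2 + 2 * rho * c).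
Let h c := lu c - 2 * s * c.

Let oneB_expR_ge0 (Z : R) : 0 <= Z -> 0 <= 1 - expR (- Z).
Proof. by move=> Z0; rewrite subr_ge0 -expR0 ler_expR oppr_le0. Qed.

Let rho0 : 0 <= rho. Proof. exact: sqrtr_ge0. Qed.
Let s0 : 0 <= s. Proof. exact: sqrtr_ge0. Qed.

Let rho_le : rho <= 1 - expR (- s).
Proof.
rewrite -ler_sqr ?nnegrE ?oneB_expR_ge0//.
rewrite sqr_sqrtr ?mulr_ge0 ?oneB_expR_ge0//; exact: one_sub_expR_mul_le.
Qed.

Let rho1 : rho < 1.
Proof. by apply: (le_lt_trans rho_le); rewrite ltrBlDr ltrDl expR_gt0. Qed.

Let u_gt0 c : -1 <= c -> 0 < 1 + rho ^+ 2 + 2 * rho * c.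
Proof.
move=> c1; have -> : 1 + rho ^+ 2 + 2 * rho * c = (1 - rho) ^+ 2 + 2 * rho * (c + 1) by ring.
rewrite ltr_wpDr ?exprn_gt0 ?subr_gt0// !mulr_ge0//; lra.
Qed.

Let lu_homo c c' : -1 <= c -> c <= c' -> lu c <= lu c'.
Proof.
move=> c1 cc; rewrite ler_ln ?posrE ?u_gt0//; last exact: le_trans cc.
by rewrite lerD2l ler_wpM2l// mulr_ge0.
Qed.

(** The value is 2 log (1 - rho) + 2 s, so this is [rho_le] in logarithmic form. *)
Let h_N1 : 0 <= h (- 1).
Proof.
rewrite /h /lu; have -> : 1 + rho ^+ 2 + 2 * rho * -1 = (1 - rho) ^+ 2 by ring.
have r10 : 0 < 1 - rho by rewrite subr_gt0.
rewrite lnXn// -mulr_natl.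
have : ln (expR (- s)) <= ln (1 - rho).
  by rewrite ler_ln ?posrE ?expR_gt0//; move: rho_le; lra.
by rewrite expRK; lra.
Qed.

(** Concavity enters through the tangent at c: if its slope [k] is nonnegative, the value at -1 is a
    lower bound for h c, otherwise the value at c' is. *)
Let h_between c c' : -1 <= c -> c <= c' -> 0 <= h c' -> 0 <= h c.
Proof.
move=> c1 cc hc'.
have H1 := ln_tangent (u_gt0 c1) (u_gt0 (lexx (- 1))).
have H2 := ln_tangent (u_gt0 c1) (u_gt0 (le_trans c1 cc)).
pose k := 2 * rho / (1 + rho ^+ 2 + 2 * rho * c) - 2 * s.
have L1 : h (- 1) <= h c + k * (- 1 - c).
  rewrite /h /k; move: H1; rewrite -/(lu (- 1)) -/(lu c).
  have -> : (1 + rho ^+ 2 + 2 * rho * -1 - (1 + rho ^+ 2 + 2 * rho * c)) / (1 + rho ^+ 2 + 2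
    * rho * c)
    = 2 * rho / (1 + rho ^+ 2 + 2 * rho * c) * (-1 - c) by field; rewrite gt_eqF ?u_gt0.
  by move: (lu _) (lu _) (_ / _) => ? ? ?; lra.
have L2 : h c' <= h c + k * (c' - c).
  rewrite /h /k; move: H2; rewrite -/(lu c') -/(lu c).
  have -> : (1 + rho ^+ 2 + 2 * rho * c' - (1 + rho ^+ 2 + 2 * rho * c)) / (1 + rho ^+ 2 + 2
    * rho * c)
    = 2 * rho / (1 + rho ^+ 2 + 2 * rho * c) * (c' - c) by field; rewrite gt_eqF ?u_gt0.
  by move: (lu _) (lu _) (_ / _) => ? ? ?; lra.
have [k0|k0] := leP 0 k.
  have : k * (- 1 - c) <= 0 by rewrite mulr_ge0_le0//; lra.
  by move: h_N1 L1; lra.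
have : k * (c' - c) <= 0 by rewrite mulr_le0_ge0 ?subr_ge0// ltW.
by move: hc' L2; lra.
Qed.

Let XYs : 0 <= X + Y - 2 * s.
Proof.
have -> : X + Y - 2 * s = (Num.sqrt X - Num.sqrt Y) ^+ 2.
  by rewrite sqrrB !sqr_sqrtr// /s sqrtrM//; ring.
exact: sqr_ge0.
Qed.

Let F1_ge0 c : -1 <= c -> 0 <= X + Y + lu c.
Proof.
move=> c1; have := lu_homo (lexx _) c1; move: h_N1 XYs; rewrite /h; lra.
Qed.

Let F2_ge0 c : -1 <= c -> 0 <= X + Y + 2 * s * c.
Proof.
move=> c1; have : - (2 * s) <= 2 * s * c.
  by rewrite -[X in X <= _]mulrN1 ler_wpM2l// mulr_ge0.
by move: XYs; lra.
Qed.

(* h changes sign at most once, from + to -, so replacing log |1 + rho z|^2 by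
   the linear function of Re z with the same mean can only raise convex means. *)
Lemma cmean_powR_ln_poisson_le :
  cmean (fun t => (X + Y + ln (u rho t)) `^ a) <=
  cmean (fun t => (X + Y + 2 * s * cosT t) `^ a).
Proof.
have a0 : 0 < a by exact: lt_trans a1.
pose A := [set c | -1 <= c <= 1 /\ 0 <= h c].
have A1 : A (- 1) by split=> //; rewrite lexx; lra.
have ubA : ubound A 1 by move=> c [/andP[]].
have supA : has_sup A by split; [exists (- 1)|exists 1].
pose c0 := sup A.
have c01 : -1 <= c0 by exact: sup_upper_bound.
(* The slope of y^a at the crossing value. Replacing the slope at F1 c by this constant is allowed
   because F2 - F1 changes sign exactly where F1 passes that value; a constant times F2 - F1 then
   has mean zero. *)
pose m := a * (X + Y + lu c0) `^ (a - 1).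
pose F1 c := X + Y + lu c.
pose F2 c := X + Y + 2 * s * c.
have key c : -1 <= c <= 1 -> F1 c `^ a + m * (F2 c - F1 c) <= F2 c `^ a.
  move=> /andP[c1 c2].
  have := powR_tangent a1 (F2_ge0 c1) (F1_ge0 c1); apply: le_trans.
  rewrite lerD2l -subr_ge0 -mulrBl.
  have E : F2 c - F1 c = - h c by rewrite /F2 /F1 /h; ring.
  rewrite -/(F2 c) -/(F1 c) E.
  have [cc|cc|->] := ltgtP c c0; last by rewrite /m subrr mul0r.
  - have hc : 0 <= h c.
      have cc0 : 0 < c0 - c by rewrite subr_gt0.
      have [c' [/andP[? ?] hc'] cc'] := sup_adherent cc0 supA.
      by apply: (h_between c1 _ hc'); apply: ltW; move: cc'; rewrite -/c0 subKr.
    rewrite mulr_le0// ?oppr_le0// subr_le0 ler_wpM2l ?(ltW a0)//.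
    apply: ge0_ler_powR; rewrite ?nnegrE ?F1_ge0 ?subr_ge0 ?(ltW a1)//.
    by rewrite lerD2l lu_homo// ltW.
  - have hc : h c <= 0.
      rewrite leNgt; apply/negP => hc.
      have /(sup_upper_bound supA) : A c by split; [rewrite c1|exact: ltW].
      by rewrite leNgt cc.
    rewrite mulr_ge0// ?oppr_ge0// subr_ge0 ler_wpM2l ?(ltW a0)//.
    apply: ge0_ler_powR; rewrite ?nnegrE ?F1_ge0 ?subr_ge0 ?(ltW a1)//.
    by rewrite lerD2l lu_homo// ltW.
have r11 : -1 < rho < 1 by rewrite rho1 (lt_le_trans _ rho0)// ltrN10.
have cl : continuous (fun t => ln (u rho t)).
  apply: continuous_comp_gt0; first exact: continuous_ln.
    exact: continuous_poisson_den.
  by move=> t; exact: poisson_den_gt0.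
have cF1 : continuous (fun t => X + Y + ln (u rho t)).
  by move=> t; apply: cvgD; [exact: cvg_cst|exact: cl].
have ccos : continuous (fun t : R => 2 * s * cosT t).
  by move=> t; apply: cvgM; [exact: cvg_cst|exact: continuous_cosT].
have cF2 : continuous (fun t : R => X + Y + 2 * s * cosT t).
  by move=> t; apply: cvgD; [exact: cvg_cst|exact: ccos].
have cK : continuous (fun _ : R => X + Y) by move=> t; exact: cvg_cst.
have cb (t : R) := cosT_bound t.
have c1a : continuous (fun t => (X + Y + ln (u rho t)) `^ a).
  apply: continuous_comp_powR => // [|t]; [exact: ltW|apply: F1_ge0].
  by case/andP: (cb t).
have c2a : continuous (fun t => (X + Y + 2 * s * cosT t) `^ a).
  apply: continuous_comp_powR => // [|t]; [exact: ltW|apply: F2_ge0].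
  by case/andP: (cb t).
have cB : continuous (fun t => (X + Y + 2 * s * cosT t) - (X + Y + ln (u rho t))).
  by move=> t; apply: cvgB; [exact: cF2|exact: cF1].
have cmB : continuous (fun t => m * ((X + Y + 2 * s * cosT t) - (X + Y + ln (u rho t)))).
  by move=> t; apply: cvgM; [exact: cvg_cst|exact: cB].
have : cmean (fun t => (X + Y + ln (u rho t)) `^ a +
     m * ((X + Y + 2 * s * cosT t) - (X + Y + ln (u rho t)))) <=
  cmean (fun t => (X + Y + 2 * s * cosT t) `^ a).
  apply: le_cmean => //.
    by move=> t; apply: cvgD; [exact: c1a|exact: cmB].
  by move=> t; exact: key.
rewrite (cmeanD c1a cmB) (cmeanZ _ cB) (cmeanB cF2 cF1) (cmeanD cK ccos) (cmeanD cK cl).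
rewrite (cmeanZ _ (@continuous_cosT R)) cmean_cosT cmean_ln_poisson_den ?rho0//.
by rewrite mulr0 subrr mulr0 addr0.
Qed.

End Comparison.

Theorem nonlinear_two_point a (p : R) X Y : 1 < a -> 1 < p -> p < 2 ->
  cmean (fun t => (2 + 2 * cosT t) `^ a) <= 2 `^ (2 * a / p) -> 0 <= X -> 0 <= Y ->
  cmean (fun t => (X + Y +
      ln (u (Num.sqrt ((1 - expR (- X)) * (1 - expR (- Y)))) t)) `^ a) <=
  (X `^ (p / 2) + Y `^ (p / 2)) `^ (2 * a / p).
Proof.
move=> a1 p1 p2 h1 X0 Y0; apply: le_trans (cmean_powR_ln_poisson_le a1 X0 Y0) _.
have H := two_point a1 p1 p2 h1 (sqrtr_ge0 X) (sqrtr_ge0 Y).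
have E Z : 0 <= Z -> Num.sqrt Z `^ p = Z `^ (p / 2).
  by move=> Z0; rewrite -powR12_sqrt// -powRrM mulrC.
rewrite (E X X0) (E Y Y0) in H.
suff <- : cmean (fun t => (Num.sqrt X ^+ 2 + Num.sqrt Y ^+ 2 +
    2 * Num.sqrt X * Num.sqrt Y * cosT t) `^ a) =
  cmean (fun t => (X + Y + 2 * Num.sqrt (X * Y) * cosT t) `^ a) by exact: H.
apply: eq_cmean => t; rewrite (sqr_sqrtr X0) (sqr_sqrtr Y0).
by rewrite sqrtrM// mulrA.
Qed.

End NonlinearComparison.

(** * The central binomial coefficient *)

Section GammaFunction.
Context {R : realType}.
Implicit Types (x y s t : R).
Local Notation mu := (@lebesgue_measure R).

(** Euler's integrand with |t| for t, hence continuous on the whole line when 1 <= x. *)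
Definition gammaf x t := `|t| `^ (x - 1) * expR (- t).

Lemma gammaf_ge0 x t : 0 <= gammaf x t.
Proof. by rewrite mulr_ge0 ?powR_ge0 ?expR_ge0. Qed.

Lemma continuous_gammaf x : 1 <= x -> continuous (gammaf x).
Proof.
move=> x1 t; apply: cvgM.
  by apply: continuous_norm_powR; rewrite subr_ge0.
apply: (@continuous_comp _ _ _ (fun t : R => - t) (@expR R)).
  exact: opp_continuous.
exact: continuous_expR.
Qed.

(** The inequality ln z <= z - 1 at z = t / (2 y); half of the exponential is kept for
    integrability. *)
Lemma powR_le_expR y t : 0 < y -> 0 <= t -> t `^ y <= (2 * y) `^ y * expR (t / 2).
Proof.
move=> y0; rewrite le_eqVlt => /predU1P[<-|t0].
  by rewrite powR0 ?gt_eqF// mulr_ge0 ?powR_ge0 ?expR_ge0.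
have y20 : 0 < 2 * y by rewrite mulr_gt0.
rewrite -ler_ln ?posrE ?mulr_gt0 ?powR_gt0 ?expR_gt0//.
rewrite lnM ?posrE ?powR_gt0 ?expR_gt0// !ln_powR expRK.
have := ln_le_subr1 (divr_gt0 t0 y20).
rewrite ln_div ?posrE// -(ler_pM2l y0).
have -> : y * (t / (2 * y) - 1) = t / 2 - y by field; rewrite gt_eqF.
by rewrite mulrBr; lra.
Qed.

Lemma gammaf_bound x : 1 <= x -> exists2 C, 0 <= C &
  forall t, 0 <= t -> gammaf x t <= C * expR (- (t / 2)).
Proof.
move=> x1.
have E t : expR (t / 2) * expR (- t) = expR (- (t / 2)).
  by rewrite -expRD; congr expR; field.
move: x1; rewrite le_eqVlt => /predU1P[<-|x1].
  exists 1 => // t t0; rewrite /gammaf subrr powRr0 !mul1r ler_expR; lra.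
exists ((2 * (x - 1)) `^ (x - 1)); first exact: powR_ge0.
move=> t t0; rewrite -E mulrA /gammaf ler_wpM2r ?expR_ge0// ger0_norm//.
by apply: powR_le_expR; rewrite ?subr_gt0.
Qed.

(** The function is twice the density of the exponential law of rate 1/2. *)
Lemma integrable_expR_half : mu.-integrable `[0, +oo[ (fun t : R => (expR (- (t / 2)))%:E).
Proof.
have h2 : 0 < 2^-1 :> R by rewrite invr_gt0.
have H1 : mu.-integrable `[0, +oo[ (EFin \o @exponential_pdf R 2^-1).
  by apply: integrableS (integrable_exponential_pdf h2).
have mI : measurable (`[0, +oo[ : set (measurableTypeR R)) by [].
have := integrableZl mI 2 H1; apply: eq_integrable => // t.
rewrite inE/= in_itv/= andbT => t0; rewrite -EFinM exponential_pdfE//.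
by congr EFin; rewrite mulrA divff// mul1r; congr expR; ring.
Qed.

Lemma integrable_gammaf x : 1 <= x -> mu.-integrable `[0, +oo[ (EFin \o gammaf x).
Proof.
move=> x1; have [C C0 hC] := gammaf_bound x1.
have mI : measurable (`[0, +oo[ : set (measurableTypeR R)) by [].
apply: (le_integrable mI _ _ (integrableZl mI C integrable_expR_half)).
  apply/measurable_EFinP; apply: measurable_funTS.
  by apply: continuous_measurable_fun; exact: continuous_gammaf.
move=> t; rewrite /= in_itv/= andbT => t0.
rewrite /= lee_fin ger0_norm ?gammaf_ge0//.
by apply: (le_trans (hC t t0)); exact: ler_norm.
Qed.

Lemma GammaE x : 1 <= x -> Gamma x = \int[mu]_(t in `[0, +oo[) gammaf x t.
Proof.
move=> x1; have iG := integrable_gammaf x1.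
rewrite -Rintegral_itv_obnd_cbnd; last first.
  apply: integrableS iG => //.
  by apply: subset_itvr; rewrite bnd_simp.
apply: eq_Rintegral => t; rewrite inE/= in_itv/= andbT => t0.
by rewrite /gammaf gtr0_norm.
Qed.

Lemma Gamma_cvg x : 1 <= x ->
  (\int[mu]_(t in `[0, n%:R]) gammaf x t) @[n --> \oo] --> Gamma x.
Proof.
move=> x1; rewrite GammaE//.
have mg : measurable_fun setT (gammaf x).
  by apply: continuous_measurable_fun; exact: continuous_gammaf.
have H := @ge0_cvgn_integral R mu (gammaf x) (gammaf_ge0 x) mg.
apply: fine_cvg; rewrite fineK//.
by apply: integrable_fin_num => //; exact: integrable_gammaf.
Qed.

Lemma powR_expR_cvg0 x : 0 < x -> (n%:R `^ x * expR (- n%:R) : R) @[n --> \oo] --> (0 : R).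
Proof.
move=> x0.
(* The extra factor t + 1 stays bounded as well, so the sequence is at most C / (n + 1). *)
have [C C0 hC] : exists2 C, 0 <= C & forall t, 0 <= t -> t `^ x * expR (- t) * (t + 1) <= C.
  have [|C1 C10 h1] := @gammaf_bound (x + 1); first lra.
  have [|C2 C20 h2] := @gammaf_bound (x + 2); first lra.
  exists (C1 + C2) => [|t t0]; first exact: addr_ge0.
  have e1 : expR (- (t / 2)) <= 1 by rewrite -expR0 ler_expR oppr_le0 divr_ge0.
  have {}h1 : gammaf (x + 1) t <= C1.
    by apply: (le_trans (h1 t t0)); rewrite ler_piMr.
  have {}h2 : gammaf (x + 2) t <= C2.
    by apply: (le_trans (h2 t t0)); rewrite ler_piMr.
  move: h1 h2; rewrite /gammaf ger0_norm// addrK.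
  have -> : x + 2 - 1 = x + 1 by ring.
  rewrite powRD; last by rewrite gt_eqF ?addr_gt0.
  by rewrite powRr1//; move: (t `^ x) (expR _) => ? ?; lra.
apply: (@squeeze_cvgr _ _ _ _ (fun=> 0) (fun n => C * harmonic n)).
- apply: nearW => n; rewrite mulr_ge0 ?powR_ge0 ?expR_ge0//=.
  rewrite /harmonic ler_pdivlMr// -natr1; exact: hC.
- exact: cvg_cst.
- rewrite -(mulr0 C); apply: cvgMr; exact: cvg_harmonic.
Qed.

(** Integration by parts on [0, n]; the boundary term n^x e^(-n) tends to 0. *)
Lemma Gamma_succ x : 1 <= x -> Gamma (x + 1) = x * Gamma x.
Proof.
move=> x1; have x0 : 0 < x by exact: lt_le_trans x1.
have x11 : 1 <= x + 1 by lra.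
pose F t := - (`|t| `^ x * expR (- t)).
have cF : continuous F.
  have -> : F = fun t => - gammaf (x + 1) t.
    by apply/funext => t; rewrite /F /gammaf addrK.
  by move=> t; apply: cvgN; exact: continuous_gammaf.
have dF t : 0 < t -> is_derive t 1 F (gammaf (x + 1) t - x * gammaf x t).
  move=> t0.
  have d1 := is_derive_powR x t0.
  have dn : is_derive t 1 (fun v => - v) (- 1) by exact: is_deriveN.
  have d2 := @is_derive_chain _ (@expR R) (fun v => - v) t _ _ (is_derive_expR _) dn.
  have d3 := is_deriveN (is_deriveM d1 d2).
  have d4 : is_derive t 1 (fun t => - (t `^ x * expR (- t))) (gammaf (x + 1) t - x * gammaf x t).
    apply: (is_derive_ext d3) => //.
    by rewrite /gammaf !gtr0_norm// addrK /GRing.scale/=; ring.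
  apply: (near_eq_is_derive _ d4).
  by near=> z; rewrite /F gtr0_norm//; near: z; exact: lt_nbhsr.
have cf : continuous (fun t => gammaf (x + 1) t - x * gammaf x t).
  move=> t; apply: cvgB; first exact: continuous_gammaf.
  by apply: cvgM; [exact: cvg_cst|exact: continuous_gammaf].
have step n : \int[mu]_(t in `[0, n%:R]) gammaf (x + 1) t =
    x * \int[mu]_(t in `[0, n%:R]) gammaf x t - n%:R `^ x * expR (- n%:R).
  case: n => [|n].
    by rewrite !set_itv1 !Rintegral_set1 mulr0 powR0 ?gt_eqF// mul0r subrr.
  have n0 : 0 < n.+1%:R :> R by [].
  have := Rintegral_FTC n0 (continuous_subspaceT cf) (continuous_subspaceT cF).
  have dF' t : 0 < t < n.+1%:R -> is_derive t 1 F (gammaf (x + 1) t - x * gammaf x t).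
    by move=> /andP[/dF].
  move=> /(_ dF'); rewrite RintegralB//; last 2 first.
  - exact: integrable_segment (continuous_gammaf x11).
  - apply: (@integrable_segment _ (fun t => x * gammaf x t)) => t.
    by apply: cvgM; [exact: cvg_cst|exact: continuous_gammaf].
  rewrite RintegralZl//; last exact: integrable_segment (continuous_gammaf x1).
  rewrite /F normr0 powR0 ?gt_eqF// mul0r oppr0 subr0 gtr0_norm//.
  by move=> /eqP; rewrite subr_eq => /eqP ->; rewrite addrC.
have L1 := Gamma_cvg x11.
have L2 : (x * \int[mu]_(t in `[0, n%:R]) gammaf x t - n%:R `^ x * expR (- n%:R)) @[n --> \oo]
     --> x * Gamma x - 0.
  apply: cvgB; last exact: powR_expR_cvg0.
  by apply: cvgMr; exact: Gamma_cvg.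
rewrite subr0 in L2; rewrite (funext step) in L1.
exact: (cvg_unique _ L1 L2).
Unshelve. all: by end_near. Qed.

Lemma Gamma_1 : Gamma 1 = 1 :> R.
Proof.
have dF (t : R) : is_derive t 1 (fun t => - expR (- t)) (gammaf 1 t).
  have dn : is_derive t 1 (fun v => - v) (- 1) by exact: is_deriveN.
  have d2 := @is_derive_chain _ (@expR R) (fun v => - v) t _ _ (is_derive_expR _) dn.
  apply: (is_derive_ext (is_deriveN d2)) => //.
  by rewrite /gammaf subrr powRr0; ring.
have cF : continuous (fun t : R => - expR (- t)).
  by move=> t; exact: is_derive_continuous (dF t).
have step n : \int[mu]_(t in `[0, n%:R]) gammaf 1 t = 1 - expR (- n%:R).
  case: n => [|n]; first by rewrite set_itv1 Rintegral_set1 oppr0 expR0 subrr.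
  have n0 : 0 < n.+1%:R :> R by [].
  rewrite (Rintegral_FTC n0 (continuous_subspaceT (continuous_gammaf (lexx 1)))
    (continuous_subspaceT cF) (fun t _ => dF t)).
  by rewrite oppr0 expR0; ring.
have L1 := Gamma_cvg (lexx (1 : R)).
have L2 : (1 - expR (- n%:R) : R) @[n --> \oo] --> (1 - 0 : R).
  apply: cvgB; first exact: cvg_cst.
  apply: (@cvg_comp _ _ _ (fun n : nat => n%:R : R) (fun x => expR (- x)) _ +oo%R); last
    exact: cvgr_expR.
  exact: cvgr_idn.
rewrite subr0 in L2; rewrite (funext step) in L1.
exact: (cvg_unique _ L1 L2).
Qed.

(* Half of the log-convexity of Gamma, by Bernoulli's inequality for (t / x)^s. *)
Lemma Gamma_add_le x s : 1 <= x -> 0 <= s <= 1 -> Gamma (x + s) <= x `^ s * Gamma x.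
Proof.
move=> x1 /andP[s0 s1]; have x0 : 0 < x by exact: lt_le_trans x1.
have xs1 : 1 <= x + s by lra.
have x11 : 1 <= x + 1 by lra.
have i0 := integrable_gammaf x1.
have i1 := integrable_gammaf x11.
have mI : measurable (`[0, +oo[ : set (measurableTypeR R)) by [].
have ixs := integrable_gammaf xs1.
(* Bernoulli's bound times x^s reads t^s <= A + B t, and the factor t turns [gammaf x] into
   [gammaf (x + 1)]. *)
pose A := x `^ s * (1 - s); pose B := x `^ s * (s / x).
have iA : mu.-integrable `[0, +oo[ (EFin \o (fun t => A * gammaf x t)).
  by have := integrableZl mI A i0; apply: eq_integrable => // t _; rewrite -EFinM.
have iB : mu.-integrable `[0, +oo[ (EFin \o (fun t => B * gammaf (x + 1) t)).
  by have := integrableZl mI B i1; apply: eq_integrable => // t _; rewrite -EFinM.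
have -> : x `^ s * Gamma x = A * Gamma x + B * Gamma (x + 1).
  by rewrite Gamma_succ// /A /B; field; rewrite gt_eqF.
rewrite !GammaE// -!RintegralZl// -RintegralD//.
apply: le_Rintegral => //.
  by have := integrableD mI iA iB; apply: eq_integrable => // t _; rewrite -EFinD.
move=> t; rewrite /= in_itv/= andbT => t0.
rewrite /gammaf ger0_norm// addrK !mulrA -mulrDl ler_wpM2r ?expR_ge0//.
move: t0; rewrite le_eqVlt => /predU1P[<-|t0].
  rewrite [0 `^ x]powR0 ?gt_eqF// mulr0 addr0.
  (* At t = 0 the convention 0^0 = 1 matters: the exponent x + s - 1 vanishes only for x = 1 and s =
     0. *)
  have [xs|xs] := eqVneq (x + s - 1) 0; last first.
    by rewrite powR0// !mulr_ge0 ?powR_ge0 ?subr_ge0.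
  have sE : s = 0 by lra.
  by rewrite /A sE addr0 powRr0 subr0 !mul1r.
have -> : t `^ (x + s - 1) = t `^ (x - 1) * t `^ s.
  by rewrite -powRD; [congr (_ `^ _); ring|rewrite (gt_eqF t0) implybT].
have -> : t `^ x = t `^ (x - 1) * t by rewrite mulrC mulr_powRB1// ltW.
have -> : t `^ s = x `^ s * (t / x) `^ s.
  by rewrite -powRM ?divr_ge0 ?ltW// mulrC divfK ?gt_eqF.
have s01 : 0 <= s <= 1 by rewrite s0 s1.
have c0 : 0 <= t `^ (x - 1) * x `^ s by rewrite mulr_ge0 ?powR_ge0.
have := ler_wpM2l c0 (powR_bernoulli s01 (ltW (divr_gt0 t0 x0))).
rewrite -mulrA => /le_trans; apply.
by rewrite le_eqVlt; apply/orP; left; apply/eqP; rewrite /A /B; field; rewrite gt_eqF.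
Qed.

(** The recurrence settles positive integers; [Gamma_add_le] from x up to the next integer transfers
    positivity to x. *)
Lemma Gamma_gt0 x : 1 <= x -> 0 < Gamma x.
Proof.
move=> x1.
have Gn n : 0 < Gamma n.+1%:R :> R.
  elim: n => [|n IH]; first by rewrite Gamma_1.
  by rewrite -natr1 Gamma_succ ?mulr_gt0// ler1n.
have x0 : 0 <= x by exact: le_trans x1.
have /andP[n1 n2] := truncn_itv x0.
pose n := Num.truncn x; pose s := n.+1%:R - x.
have s01 : 0 <= s <= 1 by rewrite /s /n -natr1 in n2 *; apply/andP; split; lra.
have := Gamma_add_le x1 s01; rewrite /s subrKC => H.
have := lt_le_trans (Gn n) H; rewrite pmulr_rgt0// powR_gt0//; lra.
Qed.

(** Increments up to 2 occur because the numerator of binom(2a, a) has argument 2 a + 1; beyond 1,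
    one step of the recurrence is split off. *)
Lemma Gamma_add_le2 x s : 1 <= x -> 0 <= s <= 2 ->
  Gamma (x + s) <= (x + s) `^ s * Gamma x.
Proof.
move=> x1 /andP[s0 s2]; have G0 := Gamma_gt0 x1.
have [s1|s1] := leP s 1.
  apply: le_trans (Gamma_add_le x1 _) _; first by rewrite s0.
  rewrite ler_wpM2r ?(ltW G0)//; apply: ge0_ler_powR; rewrite ?nnegrE//; lra.
have -> : x + s = x + (s - 1) + 1 by ring.
rewrite Gamma_succ; last lra.
have s11 : 0 <= s - 1 <= 1 by apply/andP; split; lra.
have E : (x + (s - 1) + 1) `^ s = (x + (s - 1) + 1) * (x + (s - 1) + 1) `^ (s - 1).
  by rewrite mulr_powRB1//; lra.
rewrite E -mulrA; apply: ler_pM; [lra|by apply/ltW/Gamma_gt0; lra|lra|].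
apply: le_trans (Gamma_add_le x1 s11) _.
rewrite ler_wpM2r ?(ltW G0)//; apply: ge0_ler_powR; rewrite ?nnegrE//; lra.
Qed.

End GammaFunction.

(** * The moment at rho = 1 against the central binomial coefficient *)

Section CentralBinomial.
Context {R : realType}.
Implicit Types (a s x : R) (m n : nat).
Local Notation S := pmoment.

Lemma eq_at_left1 (f g : R -> R) : {for 1, continuous f} -> {for 1, continuous g} ->
  (forall x, 0 < x < 1 -> f x = g x) -> f 1 = g 1.
Proof.
move=> cf cg fg; apply/eqP; rewrite -subr_eq0; apply/negP => /negP fg0.
have c : {for 1, continuous (fun x => f x - g x)} by apply: cvgB; [exact: cf|exact: cg].
have [e /= e0 he] := @cvgr_neq0 _ _ _ _ _ _ _ c fg0.
pose x := Num.max (1 - e / 2) (1 / 2).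
have x1 : x < 1 by rewrite gt_max; apply/andP; split; lra.
have x0 : 1 / 2 <= x by rewrite le_max lexx orbT.
have xe : 1 - e / 2 <= x by rewrite le_max lexx.
have /he/= : `|1 - x| < e by rewrite gtr0_norm; lra.
by rewrite fg ?subrr ?eqxx//; lra.
Qed.

Let in22 : -2 < (1 : R) < 2. Proof. by apply/andP; split; lra. Qed.
Let in11 x : 0 < x < 1 -> -1 < x < 1.
Proof. by move=> /andP[x0 ->]; rewrite (lt_trans _ x0)// ltrN10. Qed.

Let edge_succ a j : 0 <= a -> S (a + 1) j 1 = 2 * S a j 1 + 2 * S a j.+1 1.
Proof.
move=> a0; have a10 : 0 <= a + 1 by rewrite addr_ge0.
have H := @eq_at_left1 (S (a + 1) j)
  (fun x => (1 + x * x) * S a j x + 2 * x * S a j.+1 x).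
rewrite H ?mul1r ?mulr1//.
- by apply: continuous_pmoment.
- apply: cvgD; (apply: cvgM; last by apply: continuous_pmoment).
    by apply: cvgD; [exact: cvg_cst|apply: cvgM; exact: cvg_id].
  by apply: cvgM; [exact: cvg_cst|exact: cvg_id].
- by move=> x /in11 x1; rewrite -expr2 pmoment_succ.
Qed.

Let edge_by_parts a : 1 <= a -> S a 1 1 = 2 * a * (S (a - 1) 0 1 - S (a - 1) 2 1).
Proof.
move=> a1; have a10 : 0 <= a - 1 by rewrite subr_ge0.
have a0 : 0 <= a by rewrite (le_trans _ a1).
have H := @eq_at_left1 (S a 1) (fun x => 2 * x * a * (S (a - 1) 0 x - S (a - 1) 2 x)).
rewrite H ?mulr1//.
- by apply: continuous_pmoment.
- apply: cvgM; last by apply: cvgB; by apply: continuous_pmoment.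
  by apply: cvgM; [apply: cvgM; [exact: cvg_cst|exact: cvg_id]|exact: cvg_cst].
- by move=> x /in11 x1; rewrite pmoment_by_parts.
Qed.

(** At rho = 1 integration by parts gives (1 + a) S a 1 1 = a S a 0 1, and S (a + 1) 0 1 is twice
    the sum of these two moments. The result is the recurrence of binom(2a, a). *)
Lemma pmoment1_succ a : 1 <= a ->
  S (a + 1) 0 1 * (a + 1) = 2 * (2 * a + 1) * S a 0 1.
Proof.
move=> a1; have a10 : 0 <= a - 1 by rewrite subr_ge0.
have a0 : 0 <= a by rewrite (le_trans _ a1).
have E0 := edge_succ 0 a10; have E1 := edge_succ 1 a10; rewrite subrK in E0 E1.
have E2 := edge_by_parts a1; have E3 := edge_succ 0 a0.
have E4 : S a 1 1 = a * (S a 0 1 - S a 1 1) by rewrite {1}E2 E0 E1; ring.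
have -> : S (a + 1) 0 1 * (a + 1) = 2 * (a + 1) * S a 0 1 + 2 * (S a 1 1 + a * S a 1 1).
  by rewrite E3; ring.
by rewrite {1}E4; ring.
Qed.

Lemma pmoment1_1 : S 1 0 1 = 2 :> R.
Proof.
rewrite /pmoment (@eq_cmean _ _ (fun t : R => 2 + 2 * cosT t)); last first.
  move=> t; rewrite expr0 mulr1 powRr1 ?poisson_den_ge0// /poisson_den; ring.
have c1 : continuous (fun _ : R => 2 : R) by move=> t; exact: cvg_cst.
have c2 : continuous (fun t : R => 2 * cosT t : R).
  by move=> t; apply: cvgM; [exact: cvg_cst|exact: continuous_cosT].
rewrite (cmeanD c1 c2) cmeanZ; last exact: continuous_cosT.
by rewrite cmean_cst cmean_cosT mulr0 addr0.
Qed.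

Lemma pmoment1_add_le x s : 0 <= x -> 0 <= s ->
  S (x + s) 0 1 <= 4 `^ s * S x 0 1.
Proof.
move=> x0 s0.
have c b : 0 <= b -> continuous (fun t : R => poisson_den 1 t `^ b * cosT t ^+ 0).
  move=> b0 t; apply: cvgM; last exact: continuous_cosTX.
  by apply: continuous_comp_powR; [|exact: continuous_poisson_den|exact: poisson_den_ge0].
rewrite /pmoment -cmeanZ; last exact: c.
apply: le_cmean.
- exact: c (addr_ge0 x0 s0).
- by move=> t; apply: cvgM; [exact: cvg_cst|exact: c].
move=> t; have u0 := poisson_den_ge0 1 t; rewrite expr0 !mulr1.
have [->|s1] := eqVneq s 0; first by rewrite addr0 powRr0 mul1r.
rewrite powRD; last by rewrite paddr_eq0// (negbTE s1) andbF.
rewrite mulrC ler_wpM2r ?powR_ge0//; apply: ge0_ler_powR => //.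
+ by rewrite nnegrE.
+ by have /andP[? ?] := cosT_bound t; rewrite /poisson_den; lra.
Qed.

Local Opaque Gamma pmoment.

(* binom(2a, a) for real a. *)
Definition cbin a : R := Gamma (2 * a + 1) / Gamma (a + 1) ^+ 2.

Lemma cbin_gt0 a : 1 <= a -> 0 < cbin a.
Proof. by move=> a1; rewrite divr_gt0 ?exprn_gt0// Gamma_gt0//; lra. Qed.

Lemma cbin_succ a : 1 <= a -> cbin (a + 1) * (a + 1) = 2 * (2 * a + 1) * cbin a.
Proof.
move=> a1; have G0 : 0 < Gamma (a + 1) by apply: Gamma_gt0; lra.
rewrite /cbin.
have -> : 2 * (a + 1) + 1 = 2 * a + 1 + 1 + 1 by ring.
have h1 : 1 <= 2 * a + 1 by lra.
have h2 : 1 <= 2 * a + 1 + 1 by lra.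
have h3 : 1 <= a + 1 by lra.
rewrite (Gamma_succ h2) (Gamma_succ h1) (Gamma_succ h3).
have a10 : a + 1 != 0 by rewrite gt_eqF// (lt_le_trans _ h3).
move: (Gamma (a + 1)) (Gamma (2 * a + 1)) G0 => g1 g2 G0.
by field; rewrite a10 gt_eqF.
Qed.

Lemma cbin_1 : cbin 1 = 2.
Proof.
rewrite /cbin; have -> : 2 * 1 + 1 = 1 + 1 + 1 :> R by ring.
have h1 : 1 <= 1 :> R by [].
have h2 : 1 <= 1 + 1 :> R by rewrite lerDl.
by rewrite (Gamma_succ h2) (Gamma_succ h1) Gamma_1; field.
Qed.

Lemma pmoment1_cbin_nat m : (0 < m)%N -> S m%:R 0 1 = cbin m%:R.
Proof.
elim: m => // m IH _; case: m IH => [_|m IH]; first by rewrite pmoment1_1 cbin_1.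
have m1 : 1 <= m.+1%:R :> R by rewrite ler1n.
have m10 : m.+1%:R + 1 != 0 :> R by rewrite gt_eqF.
apply: (mulIf m10); rewrite -natr1 pmoment1_succ// cbin_succ//.
by rewrite IH.
Qed.

Lemma recurrence_ratio (f g k : R -> R) a n :
  (forall x, 1 <= x -> f (x + 1) * (x + 1) = k x * f x) ->
  (forall x, 1 <= x -> g (x + 1) * (x + 1) = k x * g x) -> 1 <= a ->
  f a * g (a + n%:R) = f (a + n%:R) * g a.
Proof.
move=> fk gk a1; elim: n => [|n IH]; first by rewrite addr0.
have an1 : 1 <= a + n%:R by rewrite (le_trans a1)// lerDl.
have an0 : a + n%:R + 1 != 0.
  by rewrite gt_eqF// (lt_le_trans (lt_le_trans ltr01 an1))// lerDl.
rewrite -natr1 addrA; apply: (mulIf an0).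
by rewrite -mulrA gk// mulrCA IH mulrAC fk// mulrA.
Qed.

Lemma pmoment1_ratio a n : 1 <= a ->
  S a 0 1 * cbin (a + n%:R) = S (a + n%:R) 0 1 * cbin a.
Proof. exact: (recurrence_ratio n pmoment1_succ cbin_succ). Qed.

Lemma powR4_mul_le x s : 0 <= x -> 0 <= s ->
  4 `^ s * (x + 1) `^ s ^+ 2 <= (2 * x + 3) `^ (2 * s).
Proof.
move=> x0 s0; have x10 : 0 <= x + 1 by lra.
have x22 : 0 <= 2 * x + 2 by lra.
have -> : 4 `^ s * (x + 1) `^ s ^+ 2 = (2 * x + 2) `^ (2 * s).
  rewrite powRrM powR_mulrn// expr2 -powRM// -powRM ?mulr_ge0//.
  by congr (_ `^ _); ring.
by apply: ge0_ler_powR; rewrite ?nnegrE ?mulr_ge0//; lra.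
Qed.

(** A lower bound for the numerator of [cbin (x + s)]: from 2 (x + s) + 1 the increment 2 - 2 s
    leads to 2 x + 3, two steps of the recurrence above 2 x + 1. *)
Lemma Gamma_double_ge x s : 1 <= x -> 0 <= s <= 1 ->
  (2 * x + 2) * (2 * x + 1) * Gamma (2 * x + 1) <=
  (2 * x + 3) `^ (2 - 2 * s) * Gamma (2 * (x + s) + 1).
Proof.
move=> x1 /andP[s0 s1].
have h1 : 1 <= 2 * (x + s) + 1 by lra.
have h2 : 0 <= 2 - 2 * s <= 2 by apply/andP; split; lra.
have h3 : 1 <= 2 * x + 1 by lra.
have h4 : 1 <= 2 * x + 1 + 1 by lra.
have E1 : 2 * (x + s) + 1 + (2 - 2 * s) = 2 * x + 1 + 1 + 1 by ring.
have E2 : 2 * x + 3 = 2 * x + 1 + 1 + 1 by ring.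
have E3 : 2 * x + 2 = 2 * x + 1 + 1 by ring.
have := Gamma_add_le2 h1 h2.
by rewrite E1 E2 E3 (Gamma_succ h4) (Gamma_succ h3) mulrA.
Qed.

(** The factor 4^s is the most by which the moment can grow in [pmoment1_add_le], and the quotient
    of squares given away here tends to 1 as x grows. *)
Lemma cbin_add_ge x s : 1 <= x -> 0 <= s <= 1 ->
  4 `^ s * cbin x * (2 * x + 1) ^+ 2 <= (2 * x + 3) ^+ 2 * cbin (x + s).
Proof.
move=> x1 s01; have /andP[s0 s1] := s01.
have x0 : 0 <= x by exact: le_trans x1.
have h1 : 1 <= x + 1 by rewrite lerDr.
have h2 : 1 <= x + s + 1 by rewrite lerDr addr_ge0.
have h3 : 1 <= 2 * x + 1 by rewrite lerDr mulr_ge0.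
have y0 : 0 < 2 * x + 3 by rewrite ltr_wpDl// mulr_ge0.
have d0 : 0 <= 2 * x + 1 by exact: le_trans h3.
have sq : (2 * x + 1) ^+ 2 <= (2 * x + 2) * (2 * x + 1).
  by rewrite expr2 ler_wpM2r// lerD2l ler1n.
have p1 := powR4_mul_le x0 s0.
have p2 : (2 * x + 3) `^ (2 * s) * (2 * x + 3) `^ (2 - 2 * s) = (2 * x + 3) ^+ 2.
  rewrite -powRD; last by rewrite (gt_eqF y0) implybT.
  have -> : 2 * s + (2 - 2 * s) = 2%:R by ring.
  by rewrite powR_mulrn// ltW.
have g1 : Gamma (x + s + 1) <= (x + 1) `^ s * Gamma (x + 1).
  by rewrite addrAC; exact: Gamma_add_le.
have g2 := Gamma_double_ge x1 s01.
have G1 := Gamma_gt0 h1; have G2 := Gamma_gt0 h2; have G3 := Gamma_gt0 h3.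
rewrite /cbin; move: G1 G2 G3 g1 g2.
move: (Gamma (x + 1)) (Gamma (x + s + 1)) (Gamma (2 * x + 1)) (Gamma (2 * (x + s) + 1)).
move=> u v w z u0 v0 w0 g1 g2.
rewrite !mulrA ler_pdivlMr ?exprn_gt0//.
have -> : 4 `^ s * w / u ^+ 2 * (2 * x + 1) * (2 * x + 1) * v ^+ 2 =
    4 `^ s * (v / u) ^+ 2 * ((2 * x + 1) ^+ 2 * w).
  by field; rewrite gt_eqF.
rewrite -p2 -[X in _ <= X]mulrA; apply: ler_pM.
- by rewrite mulr_ge0 ?powR_ge0 ?sqr_ge0.
- by rewrite mulr_ge0 ?sqr_ge0 ?(ltW w0).
- apply: le_trans p1; rewrite ler_wpM2l ?powR_ge0// lerXn2r ?nnegrE ?powR_ge0//.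
    by rewrite divr_ge0 ?(ltW v0) ?(ltW u0).
  by rewrite ler_pdivrMr.
- by apply: le_trans g2; rewrite ler_wpM2r ?(ltW w0).
Qed.

(** The two sides agree at the integer m, and their growth from m to m + s is compared. *)
Lemma pmoment1_upper m s : (0 < m)%N -> 0 <= s <= 1 ->
  S (m%:R + s) 0 1 * (2 * m%:R + 1) ^+ 2 <= (2 * m%:R + 3) ^+ 2 * cbin (m%:R + s).
Proof.
move=> m0 s01; have m1 : 1 <= m%:R :> R by rewrite ler1n.
apply: le_trans (cbin_add_ge m1 s01); rewrite ler_wpM2r ?sqr_ge0//.
by rewrite -pmoment1_cbin_nat//; apply: pmoment1_add_le => //; case/andP: s01.
Qed.

(* Both sides satisfy the same recurrence in a, so it suffices to compare them
   along a + n, where the quotient tends to 1. *)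
Lemma pmoment1_le_cbin a : 1 <= a -> S a 0 1 <= cbin a.
Proof.
move=> a1; have a0 : 0 <= a by lra.
have /andP[n1 n2] := truncn_itv a0; set n := Num.truncn a in n1 n2.
have n0 : (0 < n)%N by rewrite -(ltr0n R); move: n2; rewrite -natr1; lra.
pose s := a - n%:R.
have s01 : 0 <= s <= 1 by rewrite /s; move: n2; rewrite -natr1 => n2; apply/andP; split; lra.
have key k : S a 0 1 * (2 * (n + k)%:R + 1) ^+ 2 <= (2 * (n + k)%:R + 3) ^+ 2 * cbin a.
  have m0 : (0 < n + k)%N by rewrite addn_gt0 n0.
  have := pmoment1_upper m0 s01.
  have E : (n + k)%:R + s = a + k%:R by rewrite /s natrD; ring.
  have ak1 : 1 <= a + k%:R by rewrite (le_trans a1)// lerDl.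
  have c0 := cbin_gt0 ak1.
  rewrite E -(ler_pM2r (cbin_gt0 a1)) mulrAC -(pmoment1_ratio k a1).
  by move=> H; rewrite -(ler_pM2r c0) mulrAC [X in _ <= X]mulrAC; exact: H.
rewrite leNgt; apply/negP => lt_cS.
pose d := S a 0 1 - cbin a.
have d0 : 0 < d by rewrite subr_gt0.
have c0 := cbin_gt0 a1.
(* With y = n + k one has (2y + 3)^2 - (2y + 1)^2 = 8 (y + 1) and (2y + 1)^2 >= y (y + 1), so y d >
   8 cbin a suffices for a contradiction. *)
pose k := (Num.truncn (8 * cbin a / d)).+1.
have kP : 8 * cbin a / d < k%:R.
  have z0 : 0 <= 8 * cbin a / d 
    by apply: divr_ge0; [apply: mulr_ge0 => //; exact: ltW|exact: ltW].
  by have /andP[] := truncn_itv z0.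
have := key k; rewrite natrD.
move: kP; rewrite ltr_pdivrMr// => kP.
have nk : 0 <= n%:R :> R by [].
have kk : 0 <= k%:R :> R by [].
set y := n%:R + k%:R.
have yk : k%:R <= y by rewrite /y lerDr.
have SE : S a 0 1 = cbin a + d by rewrite /d addrC subrK.
rewrite SE leNgt => /negP; apply.
have h1 : 8 * cbin a < y * d by apply: (lt_le_trans kP); apply: ler_wpM2r yk; exact: ltW.
have y0 : 0 <= y by exact: le_trans yk.
have h2 : 8 * cbin a * (y + 1) < y * d * (y + 1) by rewrite ltr_pM2r// ltr_wpDl.
have h3 : 0 <= d * (3 * y ^+ 2 + 3 * y + 1).
  by apply: mulr_ge0; [exact: ltW|rewrite !addr_ge0// mulr_ge0// sqr_ge0].
have -> : (2 * y + 3) ^+ 2 * cbin a = (2 * y + 1) ^+ 2 * cbin a + 8 * cbin a * (y + 1) by ring.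
have -> : (cbin a + d) * (2 * y + 1) ^+ 2 = (2 * y + 1) ^+ 2 * cbin a +
  (y * d * (y + 1) + d * (3 * y ^+ 2 + 3 * y + 1)) by ring.
by rewrite ltrD2l (lt_le_trans h2)// lerDl.
Qed.

Theorem cmean_le_central_binomial (q : R) : 2 <= q ->
  cmean (fun t => (2 + 2 * cosT t) `^ (q / 2)) <= central_binomial q.
Proof.
move=> q2; have a1 : 1 <= q / 2 by lra.
have -> : central_binomial q = cbin (q / 2).
  by rewrite /central_binomial /cbin; rewrite [2 * _]mulrC divfK.
apply: le_trans (pmoment1_le_cbin a1).
rewrite le_eqVlt; apply/orP; left; apply/eqP.
apply: eq_cmean => t; rewrite expr0 mulr1 /poisson_den; congr (_ `^ _); ring.
Qed.

End CentralBinomial.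

(** * Products in SU(1,1) *)

Section SU11.
Context {R : realType}.
Local Open Scope complex_scope.
Implicit Types (z w : R[i]) (a s t : R).

Definition csq z : R := ComplexField.Normc.normc z ^+ 2.

Lemma csqE z : csq z = complex.Re z ^+ 2 + complex.Im z ^+ 2.
Proof. by case: z => x y; rewrite /csq/= sqr_sqrtr// addr_ge0 ?sqr_ge0. Qed.

Lemma csq_ge0 z : 0 <= csq z. Proof. exact: sqr_ge0. Qed.

Lemma csqM z w : csq (z * w) = csq z * csq w.
Proof. by rewrite /csq ComplexField.Normc.normcM exprMn. Qed.

Lemma csqJ z : csq (conjc z) = csq z.
Proof. by case: z => x y; rewrite !csqE/= sqrrN. Qed.

Lemma mulcJ_csq z : z * conjc z = (csq z)%:C.
Proof.
case: z => x y; rewrite csqE; apply/eqP; rewrite eq_complex/=.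
by apply/andP; split; apply/eqP; ring.
Qed.

Lemma conjcD z w : conjc (z + w) = conjc z + conjc w.
Proof. exact: (rmorphD (@conjc R)). Qed.

Lemma conjcM z w : conjc (z * w) = conjc z * conjc w.
Proof. exact: (rmorphM (@conjc R)). Qed.

Lemma mx2M (a b c d a' b' c' d' : R[i]) :
  mx2 a b c d *m mx2 a' b' c' d' =
  mx2 (a * a' + b * c') (a * b' + b * d') (c * a' + d * c') (c * b' + d * d').
Proof.
apply/matrixP => i j; rewrite !mxE !big_ord_recl big_ord0 !mxE/=.
by case: ifP => _; case: ifP => _; rewrite addr0.
Qed.

Lemma mx2_1 : mx2 1 0 0 1 = 1%:M :> 'M[R[i]]_2.
Proof.
apply/matrixP => i j; rewrite !mxE.
by case: i => [[|[]]]//= ?; case: j => [[|[]]]//= ?.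
Qed.

Lemma expipiN s : expipi (- s) = conjc (expipi s) :> R[i].
Proof. by rewrite /expipi mulrN cosN sinN. Qed.

Lemma expipi_mulJ s : expipi s * expipi (- s) = 1 :> R[i].
Proof.
rewrite expipiN mulcJ_csq csqE/= cos2Dsin2//.
Qed.

Lemma expipi_sqr s : expipi s ^+ 2 = cosT s +i* sinT s :> R[i].
Proof.
rewrite expr2 /expipi /cosT /sinT; apply/eqP; rewrite eq_complex/=.
have -> : 2 * pi * s = (pi * s) *+ 2 by rewrite -mulrA mulr_natl.
rewrite cos_mulr2n sin_mulr2n; apply/andP; split; apply/eqP.
  by rewrite -(cos2Dsin2 (pi * s)); ring.
by ring.
Qed.

Lemma invmx_phase s : invmx (phase_mx s) = phase_mx (- s) :> 'M[R[i]]_2.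
Proof.
have E : phase_mx s *m phase_mx (- s) = 1%:M :> 'M[R[i]]_2.
  rewrite /phase_mx mx2M opprK !mulr0 !mul0r !addr0 !add0r -mx2_1.
  by rewrite expipi_mulJ mulrC expipi_mulJ.
have [U _] := mulmx1_unit E.
by rewrite -[LHS]mulmx1 -E mulmxA mulVmx// mul1mx.
Qed.

Definition su11 (M : 'M[R[i]]_2) := exists z w : R[i],
  M = mx2 z w (conjc w) (conjc z) /\ z * conjc z - w * conjc w = 1.

Definition combine (M N : 'M[R[i]]_2) s := M *m phase_mx s *m N *m invmx (phase_mx s).

Lemma combineE (z0 w0 z1 w1 : R[i]) s :
  combine (mx2 z0 w0 (conjc w0) (conjc z0)) (mx2 z1 w1 (conjc w1) (conjc z1)) s =
  mx2 (z0 * z1 + w0 * conjc w1 * conjc (expipi s ^+ 2))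
      (z0 * w1 * expipi s ^+ 2 + w0 * conjc z1)
      (conjc (z0 * w1 * expipi s ^+ 2 + w0 * conjc z1))
      (conjc (z0 * z1 + w0 * conjc w1 * conjc (expipi s ^+ 2))).
Proof.
have E := expipi_mulJ s.
rewrite /combine invmx_phase /phase_mx opprK !mx2M expipiN in E *.
move: (expipi s) E => e E; rewrite !expr2 !(conjcD, conjcM, conjcK).
move: (conjc e) (conjc w0) (conjc z0) (conjc w1) (conjc z1) E => e' w0' z0' w1' z1' E.
(* In one term of each entry the phases meet as e e'; writing this 1 into the other side leaves a
   polynomial identity. *)
have F x : x = x * (e * e') by rewrite E mulr1.
congr mx2.
- by rewrite [z0 * z1]F; ring.
- by rewrite [w0 * z1']F; ring.
- by rewrite [w0' * z1]F; ring.
- by rewrite [z0' * z1']F; ring.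
Qed.

Lemma su11_combine M N s : su11 M -> su11 N -> su11 (combine M N s).
Proof.
move=> [z0 [w0 [-> E0]]] [z1 [w1 [-> E1]]].
rewrite combineE; eexists; eexists; split; first by [].
have E : expipi s ^+ 2 * conjc (expipi s ^+ 2) = 1.
  by rewrite mulcJ_csq expr2 csqM csqE cos2Dsin2 mulr1.
move: (expipi s ^+ 2) E => e E; rewrite !(conjcD, conjcM, conjcK).
have -> : 1 = (z0 * conjc z0 - w0 * conjc w0) * (z1 * conjc z1 - w1 * conjc w1) :> R[i].
  by rewrite E0 E1 mulr1.
move: (conjc e) (conjc w0) (conjc z0) (conjc w1) (conjc z1) E => e' w0' z0' w1' z1' E.
have F x : x = x * (e * e') by rewrite E mulr1.
transitivity (z0 * z1 * (z0' * z1') + w0 * w1' * (w0' * w1) * (e * e') -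
  (z0 * w1 * (z0' * w1') * (e * e') + w0 * z1' * (w0' * z1))); first by ring.
by rewrite E; ring.
Qed.

Definition logsq (M : 'M[R[i]]_2) : R := ln (csq (M ord0 ord0)).

Lemma su11_csq M : su11 M -> 1 <= csq (M ord0 ord0).
Proof.
move=> [z [w [-> E]]]; rewrite mxE/=; move: E; rewrite !mulcJ_csq => /eqP.
rewrite subr_eq eq_complex/= => /andP[/eqP-> _].
by rewrite lerDl csq_ge0.
Qed.

Lemma logsq_ge0 M : su11 M -> 0 <= logsq M.
Proof. by move=> /su11_csq; exact: ln_ge0. Qed.

(** Amplitude-phase form of a trigonometric sum. Since [acos] yields angles with nonnegative sine,
    the sign of L decides the direction of the shift. *)
Lemma phase_shift (K L r : R) : 0 <= r -> K ^+ 2 + L ^+ 2 = r ^+ 2 ->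
  exists t, forall s, K * cosT s + L * sinT s = r * cosT (s + t).
Proof.
rewrite le_eqVlt => /predU1P[<-|r0] E.
  have /eqP : K ^+ 2 + L ^+ 2 = 0 by rewrite E expr0n.
  rewrite paddr_eq0 ?sqr_ge0// !sqrf_eq0 => /andP[/eqP K0 /eqP L0].
  by exists 0 => s; rewrite K0 L0 !mul0r addr0.
have tp : 2 * pi != 0 :> R by rewrite gt_eqF// mulr_gt0// pi_gt0.
have rn : r != 0 by rewrite gt_eqF.
pose k := K / r; pose l := L / r.
have E1 : k ^+ 2 + l ^+ 2 = 1.
  by rewrite /k /l !expr_div_n -mulrDl E divff// expf_neq0.
have k1 : -1 <= k <= 1.
  rewrite -ler_norml -(@ler_pXn2r _ 2) ?nnegrE// expr1n real_normK ?num_real//.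
  by rewrite -E1 lerDl sqr_ge0.
have kI : k \in `[(-1), 1] by rewrite in_itv.
have KE : K = r * k by rewrite mulrC divfK.
have LE : L = r * l by rewrite mulrC divfK.
have sE : Num.sqrt (1 - k ^+ 2) = `|l|.
  by rewrite -E1 addrAC subrr add0r sqrtr_sqr.
have [l0|l0] := leP 0 l.
- exists (- (acos k / (2 * pi))) => s.
  have -> : cosT (s - acos k / (2 * pi)) = cos (2 * pi * s - acos k).
    by rewrite /cosT mulrBr [2 * pi * (_ / _)]mulrCA divff// mulr1.
  rewrite cosB -/(cosT s) -/(sinT s).
  by rewrite acosK// sin_acos// sE ger0_norm// KE LE; ring.
- exists (acos k / (2 * pi)) => s.
  have -> : cosT (s + acos k / (2 * pi)) = cos (2 * pi * s + acos k).
    by rewrite /cosT mulrDr [2 * pi * (_ / _)]mulrCA divff// mulr1.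
  rewrite cosD -/(cosT s) -/(sinT s).
  by rewrite acosK// sin_acos// sE ltr0_norm// KE LE; ring.
Qed.

(** The new entry is z0 z1 times 1 + c e^(-2 pi i s) with c = w0 conj(w1) / (z0 z1). Because |w|^2 =
    |z|^2 - 1, the modulus of c is rho; its argument becomes the shift t. *)
Lemma logsq_combine M N : su11 M -> su11 N -> exists t, forall s,
  logsq (combine M N s) = logsq M + logsq N + ln (poisson_den
    (Num.sqrt ((1 - expR (- logsq M)) * (1 - expR (- logsq N)))) (s + t)).
Proof.
move=> sM sN; have M1 := su11_csq sM; have N1 := su11_csq sN.
have expL P : su11 P -> expR (- logsq P) = (csq (P ord0 ord0))^-1.
  move=> /su11_csq P1.
  by rewrite expRN /logsq lnK// posrE (lt_le_trans ltr01).
have oneB P : su11 P -> 0 <= 1 - expR (- logsq P) < 1.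
  move=> sP; rewrite ltrBlDr ltrDl expR_gt0 andbT subr_ge0 -expR0 ler_expR.
  by rewrite oppr_le0 logsq_ge0.
have /andP[rM rM1] := oneB M sM; have /andP[rN rN1] := oneB N sN.
have rho1 : Num.sqrt ((1 - expR (- logsq M)) * (1 - expR (- logsq N))) < 1.
  rewrite -[ltRHS]sqrtr1 ltr_sqrt// -[ltRHS]mulr1; exact: ltr_pM.
move: rM rN rho1; rewrite !expL//.
case: sM sN M1 N1 {oneB expL rM1 rN1} => [z0 [w0 [-> E0]]] [z1 [w1 [-> E1]]].
rewrite !mxE/= /logsq !mxE/= => M1 N1.
have cw z w : z * conjc z - w * conjc w = 1 -> csq w = csq z - 1.
  rewrite !mulcJ_csq => /eqP; rewrite subr_eq eq_complex/= => /andP[/eqP-> _].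
  by rewrite addrAC subrr add0r.
have {}E0 := cw _ _ E0; have {}E1 := cw _ _ E1.
have p0 : 0 < csq z0 by exact: lt_le_trans M1.
have p1 : 0 < csq z1 by exact: lt_le_trans N1.
set rho := Num.sqrt _ => rM rN rho1.
have rho0 : 0 <= rho by exact: sqrtr_ge0.
have rho2 : rho ^+ 2 * (csq z0 * csq z1) = csq w0 * csq w1.
  by rewrite sqr_sqrtr ?mulr_ge0// E0 E1; field; rewrite !gt_eqF.
case Ea : (z0 * z1) => [k l]; case Eb : (w0 * conjc w1) => [g h].
have Ca : csq z0 * csq z1 = k ^+ 2 + l ^+ 2 by rewrite -csqM Ea csqE.
have Cb : csq w0 * csq w1 = g ^+ 2 + h ^+ 2 by rewrite -[csq w1]csqJ -csqM Eb csqE.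
have r0 : 0 <= rho * (csq z0 * csq z1) by apply: mulr_ge0 => //; apply: mulr_ge0; exact: csq_ge0.
(* Lagrange's identity: up to sign, the two squared terms are the real and imaginary parts of z0 z1
   times the conjugate of w0 conj(w1). *)
have Er : (k * g + l * h) ^+ 2 + (k * h - l * g) ^+ 2 = (rho * (csq z0 * csq z1)) ^+ 2.
  transitivity ((csq z0 * csq z1) * (rho ^+ 2 * (csq z0 * csq z1))); last by ring.
  by rewrite rho2 Ca Cb; ring.
have [t Et] := phase_shift r0 Er.
exists t => s; rewrite combineE expipi_sqr mxE/= Ea Eb.
have cs : cosT s ^+ 2 + sinT s ^+ 2 = 1 :> R by exact: cos2Dsin2.
have -> : (k +i* l) + (g +i* h) * (cosT s -i* sinT s) =
    (k + (g * cosT s + h * sinT s)) +i* (l + (h * cosT s - g * sinT s)).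
  by apply/eqP; rewrite eq_complex/=; apply/andP; split; apply/eqP; ring.
have -> : csq ((k + (g * cosT s + h * sinT s)) +i* (l + (h * cosT s - g * sinT s))) =
    (csq z0 * csq z1) * poisson_den rho (s + t).
  rewrite csqE /poisson_den /=.
  have -> : csq z0 * csq z1 * (1 + rho ^+ 2 + 2 * rho * cosT (s + t)) =
    csq z0 * csq z1 + rho ^+ 2 * (csq z0 * csq z1) + 2 * (rho * (csq z0 * csq z1) * cosT (s +
      t)) by ring.
  transitivity (k ^+ 2 + l ^+ 2 + (g ^+ 2 + h ^+ 2) * (cosT s ^+ 2 + sinT s ^+ 2) +
    2 * ((k * g + l * h) * cosT s + (k * h - l * g) * sinT s)); first by ring.
  by rewrite cs mulr1 Et rho2 Cb Ca.
have u0 : 0 < poisson_den rho (s + t).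
  by apply: poisson_den_gt0; rewrite rho1 (lt_le_trans _ rho0)// ltrN10.
rewrite lnM ?posrE//; last exact: mulr_gt0.
by rewrite lnM ?posrE.
Qed.

(** As s is uniform on the circle, the shift in [logsq_combine] drops out of the mean, and the
    nonlinear inequality applies. *)
Theorem cmean_combine (q p : R) M N : 2 < q -> 1 < p -> p < 2 ->
  cmean (fun t => (2 + 2 * cosT t) `^ (q / 2)) <= 2 `^ (q / p) ->
  su11 M -> su11 N ->
  continuous (fun s => logsq (combine M N s) `^ (q / 2)) /\
  cmean (fun s => logsq (combine M N s) `^ (q / 2)) <=
    (logsq M `^ (p / 2) + logsq N `^ (p / 2)) `^ (q / p).
Proof.
move=> q2 p1 p2 h1 sM sN; have [t Et] := logsq_combine sM sN.
have a1 : 1 < q / 2 by rewrite ltr_pdivlMr ?mul1r.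
have X0 := logsq_ge0 sM; have Y0 := logsq_ge0 sN.
have q2E : 2 * (q / 2) = q by rewrite mulrC divfK.
have := @nonlinear_two_point R (q / 2) p _ _ a1 p1 p2 _ X0 Y0.
rewrite q2E => /(_ h1).
set rho := Num.sqrt _.
pose F s := (logsq M + logsq N + ln (poisson_den rho s)) `^ (q / 2).
have EF : (fun s => logsq (combine M N s) `^ (q / 2)) = (fun s => F (s + t)).
  by apply/funext => s; rewrite Et.
have oneB P : su11 P -> 0 <= 1 - expR (- logsq P) < 1.
  move=> sP; rewrite ltrBlDr ltrDl expR_gt0 andbT subr_ge0 -expR0 ler_expR.
  by rewrite oppr_le0 logsq_ge0.
have /andP[rM rM1] := oneB M sM; have /andP[rN rN1] := oneB N sN.
have rho1 : -1 < rho < 1.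
  rewrite (lt_le_trans _ (sqrtr_ge0 _)) ?ltrN10//=.
  rewrite -[ltRHS]sqrtr1 ltr_sqrt// -[ltRHS]mulr1; exact: ltr_pM.
have F0 s : 0 <= logsq M + logsq N + ln (poisson_den rho s).
  have := Et (s - t); rewrite subrK -/rho => <-.
  by apply/logsq_ge0/su11_combine.
have cF : continuous F.
  apply: continuous_comp_powR; first by rewrite ltW// (lt_trans ltr01).
    move=> s; apply: cvgD; first exact: cvg_cst.
    apply: (@continuous_comp_gt0 _ (@ln R)); first exact: continuous_ln.
      exact: continuous_poisson_den.
    by move=> ?; exact: poisson_den_gt0.
  exact: F0.
move=> H; split.
  rewrite EF => s; apply: (@continuous_comp _ _ _ (fun s => s + t) F); last exact: cF.
  by apply: cvgD; [exact: cvg_id|exact: cvg_cst].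
rewrite EF cmean_shift// => s; rewrite /F; congr ((_ + ln _) `^ _).
by rewrite /poisson_den cosTD1.
Qed.

End SU11.

(** * Integration over the torus *)

Section ComplexMeasurability.
Context {R : realType} {disp : measure_display} {T : measurableType disp}.
Local Open Scope complex_scope.
Implicit Types (f g : T -> R[i]) (F G : T -> 'M[R[i]]_2).

Definition cmeasurable f := measurable_fun setT (fun x => complex.Re (f x)) /\
  measurable_fun setT (fun x => complex.Im (f x)).

Lemma cmeasurable_cst (z : R[i]) : cmeasurable (fun=> z).
Proof. by split; exact: measurable_cst. Qed.

Lemma cmeasurableD f g : cmeasurable f -> cmeasurable g ->
  cmeasurable (fun x => f x + g x).
Proof.
move=> [f1 f2] [g1 g2]; split.
- have -> : (fun x => complex.Re (f x + g x)) = (fun x => complex.Re (f x) + complex.Re (g x)).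
    by apply/funext => x; case: (f x); case: (g x).
  exact: measurable_funD.
- have -> : (fun x => complex.Im (f x + g x)) = (fun x => complex.Im (f x) + complex.Im (g x)).
    by apply/funext => x; case: (f x); case: (g x).
  exact: measurable_funD.
Qed.

Lemma cmeasurableM f g : cmeasurable f -> cmeasurable g ->
  cmeasurable (fun x => f x * g x).
Proof.
move=> [f1 f2] [g1 g2]; split.
- have -> : (fun x => complex.Re (f x * g x)) = (fun x => complex.Re (f x) * complex.Re (g x)
  - complex.Im (f x) * complex.Im (g x)).
    by apply/funext => x; case: (f x); case: (g x).
  by apply: measurable_funB; exact: measurable_funM.
- have -> : (fun x => complex.Im (f x * g x)) = (fun x => complex.Re (f x) * complex.Im (g x)
  + complex.Im (f x) * complex.Re (g x)).
    by apply/funext => x; case: (f x); case: (g x).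
  by apply: measurable_funD; exact: measurable_funM.
Qed.

Lemma cmeasurable_expipi (h : T -> R) : measurable_fun setT h ->
  cmeasurable (fun x => expipi (h x)).
Proof.
move=> mh; have mp : measurable_fun setT (fun x => pi * h x).
  by apply: measurable_funM => //; exact: measurable_cst.
split; apply: (measurableT_comp _ mp); apply: continuous_measurable_fun.
  exact: continuous_cos.
exact: continuous_sin.
Qed.

Definition mxmeasurable F := forall i j, cmeasurable (fun x => F x i j).

Lemma mxmeasurable_cst M : mxmeasurable (fun=> M).
Proof. by move=> i j; exact: cmeasurable_cst. Qed.

Lemma mxmeasurableM F G : mxmeasurable F -> mxmeasurable G ->
  mxmeasurable (fun x => F x *m G x).
Proof.
move=> mF mG i j.
have -> : (fun x => (F x *m G x) i j) = (fun x =>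
    F x i ord0 * G x ord0 j + F x i (lift ord0 ord0) * G x (lift ord0 ord0) j).
  by apply/funext => x; rewrite mxE !big_ord_recl big_ord0 addr0.
by apply: cmeasurableD; exact: cmeasurableM.
Qed.

Lemma mxmeasurable_phase (h : T -> R) : measurable_fun setT h ->
  mxmeasurable (fun x => phase_mx (h x)).
Proof.
move=> mh i j.
have mhN : measurable_fun setT (fun x => - h x) by exact: measurableT_comp.
have -> : (fun x => phase_mx (h x) i j) = (fun x => if i == ord0 then
    (if j == ord0 then expipi (h x) else 0) else (if j == ord0 then 0 else expipi (- h x))).
  by apply/funext => x; rewrite mxE.
by case: (i == ord0); case: (j == ord0); [exact: (cmeasurable_expipi mh)|exact: cmeasurable_cst
  |exact: cmeasurable_cst|exact: (cmeasurable_expipi mhN)].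
Qed.

Lemma measurable_logsq F : mxmeasurable F -> measurable_fun setT (fun x => logsq (F x)).
Proof.
move=> /(_ ord0 ord0)[m1 m2].
have -> : (fun x => logsq (F x)) = (fun x => ln (complex.Re (F x ord0 ord0) ^+ 2 + complex.Im
  (F x ord0 ord0) ^+ 2)).
  by apply/funext => x; rewrite /logsq csqE.
apply: (@measurableT_comp _ _ _ _ _ _ (@ln R)); first exact: measurable_ln.
by apply: measurable_funD; exact: measurable_funX.
Qed.

End ComplexMeasurability.

(** * Norm bounds and Minkowski's inequality for integrals of powers *)

Section LnormBounds.
Context {R : realType} {disp : measure_display} {T : measurableType disp}.
Variable mu : {measure set T -> \bar R}.
Implicit Types (f : T -> R) (m B : R).

Let Lnorm_integral f m : (forall x, 0 <= f x) ->
  (\int[mu]_x `|(f x)%:E| `^ m = \int[mu]_x (f x `^ m)%:E)%E.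
Proof.
by move=> f0; apply: eq_integral => x _; rewrite /= ger0_norm// poweR_EFin.
Qed.

Lemma Lnorm_le f m B : 0 < m -> 0 <= B -> (forall x, 0 <= f x) ->
  (\int[mu]_x (f x `^ m)%:E <= (B `^ m)%:E)%E -> (Lnorm mu m%:E (EFin \o f) <= B%:E)%E.
Proof.
move=> m0 B0 f0 fB; rewrite unlock/= Lnorm_integral//.
have -> : B%:E = ((B `^ m)%:E `^ m^-1)%E.
  by rewrite poweR_EFin -powRrM divff ?gt_eqF// powRr1.
apply: gt0_ler_poweR => //.
- by rewrite invr_ge0 ltW.
- by rewrite in_itv/= leey andbT integral_ge0// => x _; rewrite lee_fin powR_ge0.
- by rewrite in_itv/= leey andbT lee_fin powR_ge0.
Qed.

Lemma le_of_Lnorm f m B : 0 < m -> 0 <= B -> (forall x, 0 <= f x) ->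
  (Lnorm mu m%:E (EFin \o f) <= B%:E)%E -> (\int[mu]_x (f x `^ m)%:E <= (B `^ m)%:E)%E.
Proof.
move=> m0 B0 f0 fB; rewrite -Lnorm_integral//.
have := @powR_Lnorm _ _ _ mu (EFin \o f) m (lt0r_neq0 m0) => /= <-.
rewrite -poweR_EFin; apply: gt0_ler_poweR => //.
- exact: ltW.
- by rewrite in_itv/= leey andbT Lnorm_ge0.
- by rewrite in_itv/= leey andbT lee_fin.
Qed.

(** Minkowski's inequality without roots: with bounds written as powers, an induction only has to
    add A and B. *)
Lemma integral_powRD_le f (g : T -> R) m A B : 1 <= m -> 0 <= A -> 0 <= B ->
  measurable_fun setT f -> measurable_fun setT g ->
  (forall x, 0 <= f x) -> (forall x, 0 <= g x) ->
  (\int[mu]_x (f x `^ m)%:E <= (A `^ m)%:E)%E ->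
  (\int[mu]_x (g x `^ m)%:E <= (B `^ m)%:E)%E ->
  (\int[mu]_x ((f x + g x) `^ m)%:E <= ((A + B) `^ m)%:E)%E.
Proof.
move=> m1 A0 B0 mf mg f0 g0 fA gB; have m0 : 0 < m by exact: lt_le_trans m1.
apply: (@le_of_Lnorm (fun x => f x + g x)) => //.
- exact: addr_ge0.
- by move=> x; exact: addr_ge0.
- apply: (le_trans (@minkowski_EFin _ _ _ mu f g m mf mg m1)).
  by rewrite EFinD leeD// Lnorm_le.
Qed.

End LnormBounds.

(** * Subadditivity along the tree *)

Section RootMatrixBound.
Context {R : realType}.
Local Notation MT := (measurableTypeR R).
Variables (d : nat) (G : d.-tuple bool -> 'M[R[i]]_2).
Hypothesis sG : forall w, su11 (G w).
Implicit Types (sigma : seq bool) (n : nat).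

Lemma su11_1 : su11 (1%:M : 'M[R[i]]_2).
Proof.
exists 1, 0; rewrite conjc0 conjc1; split; first by rewrite mx2_1.
by rewrite mul0r mulr1 subr0.
Qed.

(** Words of every length are covered, since the default leaf, the identity, lies in SU(1,1) too. *)
Lemma su11_node (t : seq R) n sigma : su11 (node_mx G t n sigma).
Proof.
elim: n sigma => [|n IH] sigma /=; last exact: su11_combine.
by case: insub => [w|] /=; [exact: sG|exact: su11_1].
Qed.

Lemma eq_node_mx (t t' : seq R) n sigma : (forall k, (k < n)%N -> t`_k = t'`_k) ->
  node_mx G t n sigma = node_mx G t' n sigma.
Proof.
elim: n sigma => [//|n IH] sigma tt' /=.
by rewrite tt'// !IH// => k kn; apply: tt'; exact: ltnW.
Qed.

(** This follows the recursion of [torus_measure]: the children depend on x only, and the appended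
    coordinate s is the phase of the new node. *)
Lemma node_mx_rcons n (x : n.-tuple MT) (s : MT) sigma :
  node_mx G (tuple_rcons (x, s)) n.+1 sigma =
  combine (node_mx G x n (rcons sigma false)) (node_mx G x n (rcons sigma true)) s.
Proof.
have E tau : node_mx G (tuple_rcons (x, s)) n tau = node_mx G x n tau.
  by apply: eq_node_mx => k kn; rewrite /= nth_rcons size_tuple kn.
by rewrite [LHS]/= !E nth_rcons size_tuple ltnn eqxx.
Qed.

Lemma mxmeasurable_node m n sigma : (n <= m)%N ->
  mxmeasurable (fun t : m.-tuple MT => node_mx G t n sigma).
Proof.
elim: n sigma => [|n IH] sigma nm /=; first exact: mxmeasurable_cst.
have mn : measurable_fun setT (fun t : m.-tuple MT => (t : seq R)`_n).
  have -> : (fun t : m.-tuple MT => (t : seq R)`_n) = (fun t : m.-tuple MT => tnth t (Ordinal nm)).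
    by apply/funext => t; rewrite (tnth_nth 0).
  exact: measurable_tnth.
apply: mxmeasurableM; last first.
  have -> : (fun t : m.-tuple MT => invmx (phase_mx (t : seq R)`_n)) = (fun t : m.-tuple MT
    => phase_mx (- (t : seq R)`_n)).
    by apply/funext => t; rewrite invmx_phase.
  by apply: mxmeasurable_phase; exact: measurableT_comp.
apply: mxmeasurableM; last exact: IH (ltnW nm).
by apply: mxmeasurableM; [exact: IH (ltnW nm)|exact: mxmeasurable_phase].
Qed.

Variables (q p : R).
Hypotheses (q2 : 2 < q) (p1 : 1 < p) (p2 : p < 2).
Hypothesis critical : cmean (fun t => (2 + 2 * cosT t) `^ (q / 2)) <= 2 `^ (q / p).

Let p0 : 0 < p := lt_trans ltr01 p1.

(** The q-th power of the L^q norm of the square root of [logsq], over just the n coordinates on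
    which the node depends. *)
Definition node_energy n sigma : \bar R :=
  (\int[torus_measure R n]_t (logsq (node_mx G t n sigma) `^ (q / 2))%:E)%E.

(** A and B bound the p-th powers of the children's norms. For fixed x, [cmean_combine] bounds the
    integral over s; Minkowski's inequality in L^(q/p) for [logsq] to the power p / 2 then separates
    the children. *)
Lemma node_energy_succ n sigma A B : 0 <= A -> 0 <= B ->
  (node_energy n (rcons sigma false) <= (A `^ (q / p))%:E)%E ->
  (node_energy n (rcons sigma true) <= (B `^ (q / p))%:E)%E ->
  (node_energy n.+1 sigma <= ((A + B) `^ (q / p))%:E)%E.
Proof.
move=> A0 B0 hA hB.
pose f (t : n.+1.-tuple MT) := ((logsq (node_mx G t n.+1 sigma)) `^ (q / 2))%:E.
have mL m tau k : (k <= m)%N -> measurable_fun setT (fun t : m.-tuple MT => logsq (node_mx G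
  t k tau)).
  by move=> km; apply: measurable_logsq; exact: mxmeasurable_node.
have mpow k m tau (e : R) : (k <= m)%N ->
    measurable_fun setT (fun t : m.-tuple MT => logsq (node_mx G t k tau) `^ e).
  by move=> km; apply: (@measurableT_comp _ _ _ _ _ _ (fun x => x `^ e)); [exact:
    measurable_powR|exact: mL].
have mf : measurable_fun setT f by apply/measurable_EFinP; exact: mpow.
have f0 t : (0 <= f t)%E by rewrite lee_fin powR_ge0.
have fr0 x : (0 <= (f \o @tuple_rcons R n) x)%E by exact: f0.
rewrite /node_energy.
have E := @ge0_integral_distribution _ _ _ _ R (torus_measure R n \x circle_measure R)%E
  (@tuple_rcons R n) f mf f0.
rewrite (_ : (\int[_]_t _)%E = (\int[(torus_measure R n \x circle_measure R)]_x (f \o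
  @tuple_rcons R n) x)%E); last exact: E.
have mfr : measurable_fun setT (f \o @tuple_rcons R n).
  by apply: measurableT_comp => //; exact: measurable_tuple_rcons.
rewrite (@fubini_tonelli1 _ _ _ _ R (torus_measure R n) (circle_measure R) (f \o @tuple_rcons
  R n))//.
pose X0 (x : n.-tuple MT) := logsq (node_mx G x n (rcons sigma false)) `^ (p / 2).
pose X1 (x : n.-tuple MT) := logsq (node_mx G x n (rcons sigma true)) `^ (p / 2).
apply: (@le_trans _ _ (\int[torus_measure R n]_x ((X0 x + X1 x) `^ (q / p))%:E)%E).
  apply: ge0_le_integral => //.
  - move=> x _; apply: integral_ge0 => s _; exact: f0.
  - exact: measurable_fun_fubini_tonelli_F.
  - apply/measurable_EFinP; apply: (@measurableT_comp _ _ _ _ _ _ (fun x => x `^ (q / p))).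
      exact: measurable_powR.
    by apply: measurable_funD; exact: mpow.
  move=> x _; rewrite /fubini_F /circle_measure.
  rewrite integral_uniform; last 2 first.
  - exact: (measurableT_comp mfr (measurable_pair1 x)).
  - by move=> s; exact: f0.
  rewrite subr0 invr1 mul1e.
  have [cC leC] := cmean_combine q2 p1 p2 critical
    (su11_node x n (rcons sigma false)) (su11_node x n (rcons sigma true)).
  rewrite (_ : (fun s : MT => (f \o @tuple_rcons R n) (x, s)) = EFin \o (fun s =>
    logsq (combine (node_mx G x n (rcons sigma false)) (node_mx G x n (rcons sigma true)) s)
      `^ (q / 2))); last first.
    by apply/funext => s; rewrite /comp /f node_mx_rcons.
  rewrite -[leLHS]fineK; last by apply: integrable_fin_num => //; exact: integrable_unit.
  by rewrite lee_fin.
have qp1 : 1 <= q / p by rewrite ler_pdivlMr// mul1r ltW// (lt_trans p2).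
apply: (@integral_powRD_le _ _ _ (torus_measure R n) X0 X1 (q / p) A B qp1 A0 B0
  (mpow _ _ _ _ (leqnn n)) (mpow _ _ _ _ (leqnn n))
  (fun x => powR_ge0 _ _) (fun x => powR_ge0 _ _)).
- apply: le_trans hA; rewrite le_eqVlt; apply/orP; left; apply/eqP.
  apply: eq_integral => x _; rewrite /X0 -powRrM; congr (_ `^ _)%:E.
  by field; rewrite gt_eqF.
- apply: le_trans hB; rewrite le_eqVlt; apply/orP; left; apply/eqP.
  apply: eq_integral => x _; rewrite /X1 -powRrM; congr (_ `^ _)%:E.
  by field; rewrite gt_eqF.
Qed.

Lemma node_energy0 (w : d.-tuple bool) :
  node_energy 0 w = (logsq (G w) `^ (q / 2))%:E.
Proof.
rewrite /node_energy /=.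
have -> : insub (val w) = Some w by rewrite valK.
rewrite /= integral_cst//= probability_setT mule1//.
Qed.

End RootMatrixBound.

(** * The leaves and their count *)

Section Leaves.
Context {R : realType}.
Variables (d : nat) (E : {set d.-tuple bool}) (r : R).
Hypotheses (r0 : 0 <= r) (r1 : r < 1).

Let r2 : 0 < 1 - r ^+ 2. Proof. by rewrite subr_gt0 expr_lt1. Qed.

Lemma logsq_1 : logsq (1%:M : 'M[R[i]]_2) = 0.
Proof.
by rewrite /logsq mxE/= /csq ComplexField.Normc.normc1 expr1n ln1.
Qed.

Lemma su11_leaf w : su11 (leaf_mx E r w).
Proof.
rewrite /leaf_mx; case: ifP => _; last exact: su11_1.
set c := (Num.sqrt (1 - r ^+ 2))^-1.
exists (c%:C)%C, (c%:C * r%:C)%C; rewrite conjcM !conjc_real; split.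
  by apply/matrixP => i j; rewrite !mxE; case: ifP => _; case: ifP => _; rewrite ?mulr1.
have c2 : c ^+ 2 * (1 - r ^+ 2) = 1.
  by rewrite /c exprVn sqr_sqrtr ?(ltW r2)// mulVf// gt_eqF.
apply/eqP; rewrite eq_complex/=; apply/andP; split; apply/eqP.
  by rewrite -c2; ring.
by ring.
Qed.

Lemma logsq_leaf w : logsq (leaf_mx E r w) = if w \in E then ln (1 / (1 - r ^+ 2)) else 0.
Proof.
rewrite /leaf_mx; case: ifP => _; last exact: logsq_1.
rewrite /logsq !mxE/= mulr1 csqE/= expr0n addr0 exprVn sqr_sqrtr ?(ltW r2)//.
by rewrite div1r.
Qed.

Definition leaves_below sigma := [set w in E | take (size sigma) w == sigma].

Lemma card_leaves_below sigma : (size sigma < d)%N ->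
  #|leaves_below sigma| = (#|leaves_below (rcons sigma false)| + #|leaves_below (rcons sigma
    true)|)%N.
Proof.
move=> sd; rewrite -(cardsID [set w : d.-tuple bool | nth false w (size sigma)] (leaves_below
  sigma)) addnC.
have key b (w : d.-tuple bool) : (take (size (rcons sigma b)) w == rcons sigma b) =
    (take (size sigma) w == sigma) && (nth false w (size sigma) == b).
  by rewrite size_rcons (take_nth false) ?size_tuple// eqseq_rcons.
by congr (_ + _)%N; apply: eq_card => w; rewrite !inE key; case: nth; rewrite ?andbT ?andbF.
Qed.

Lemma leaves_below_full (w : d.-tuple bool) : #|leaves_below w| = (w \in E) :> nat.
Proof.
have -> : leaves_below w = E :&: [set w]%SET.
  apply/setP => v; rewrite !inE; congr (_ && _).
  by rewrite size_tuple take_oversize ?size_tuple.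
have [wE|wE] := boolP (w \in E).
  by rewrite (_ : E :&: [set w]%SET = [set w]%SET) ?cards1//; apply/finset.setIidPr; rewrite
    finset.sub1set.
by apply/eqP; rewrite cards_eq0; apply/eqP/setP => v; rewrite !inE; case: eqP => [->|];
  rewrite ?(negbTE wE)// andbF.
Qed.

Lemma leaves_below_nil : leaves_below [::] = E.
Proof. by apply/setP => w; rewrite !inE take0 eqxx andbT. Qed.

(** Each leaf in E contributes log (1 / (1 - r^2)) to the power p / 2, any other leaf 0, and these
    p-th powers add up along the tree. *)
Lemma node_energy_le (q p : R) n sigma : 2 < q -> 1 < p -> p < 2 ->
  cmean (fun t => (2 + 2 * cosT t) `^ (q / 2)) <= 2 `^ (q / p) ->
  (size sigma + n = d)%N ->
  (node_energy (leaf_mx E r) q n sigma <=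
   ((#|leaves_below sigma|%:R * ln (1 / (1 - r ^+ 2)) `^ (p / 2)) `^ (q / p))%:E)%E.
Proof.
move=> q2 p1 p2 h1; have p0 : 0 < p by exact: lt_trans p1.
have qp0 : 0 < q / p by rewrite divr_gt0// (lt_trans _ q2).
elim: n sigma => [|n IH] sigma sd.
  (* At height 0 the word has full length d, so it is a genuine leaf and the default value does not
     occur. *)
  have /eqP sz : size sigma = d by rewrite -sd addn0.
  have -> : sigma = val (Tuple sz) by [].
  rewrite node_energy0 leaves_below_full logsq_leaf lee_fin; case: ifP => _ /=.
    by rewrite [1 * _ `^ _]mul1r -powRrM; have -> : p / 2 * (q / p) = q / 2 by field; rewrite
      gt_eqF.
  by rewrite mul0r !powR0 ?gt_eqF// divr_gt0// (lt_trans _ q2).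
have sn : (size sigma < d)%N by rewrite -sd addnS ltnS leq_addr.
rewrite card_leaves_below// natrD mulrDl.
apply: node_energy_succ => //.
- exact: su11_leaf.
- by rewrite mulr_ge0 ?powR_ge0.
- by rewrite mulr_ge0 ?powR_ge0.
- by apply: IH; rewrite size_rcons -sd addSnnS.
- by apply: IH; rewrite size_rcons -sd addSnnS.
Qed.

End Leaves.

(** Exponentiated, the hypothesis reads binom(q, q/2) <= 2^(q/p), and the left side dominates E |1 +
    z|^q. *)
Lemma critical_exponent (R : realType) (p q : R) : 0 < p -> 2 < q ->
  q^-1 * log2 (central_binomial q) <= p^-1 ->
  cmean (fun t => (2 + 2 * cosT t) `^ (q / 2)) <= 2 `^ (q / p).
Proof.
move=> p0 q2 hpq; have q0 : 0 < q by exact: lt_trans q2.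
have ln20 : 0 < ln 2 :> R by rewrite ln_gt0// ltr1n.
have cb0 : 0 < central_binomial q.
  by rewrite /central_binomial divr_gt0 ?exprn_gt0// Gamma_gt0//; lra.
apply: (le_trans (cmean_le_central_binomial (ltW q2))).
rewrite -ler_ln ?posrE ?powR_gt0// ln_powR -ler_pdivrMr//.
have : log2 (central_binomial q) <= p^-1 * q by rewrite -ler_pdivrMr// mulrC.
by rewrite mulrC.
Qed.

Lemma powR_sqrt_mul (R : realType) (x l p q : R) : 0 <= x -> 0 <= l -> 0 < p ->
  (x `^ p^-1 * Num.sqrt l) `^ q = (x * l `^ (p / 2)) `^ (q / p).
Proof.
move=> x0 l0 p0; rewrite -(powR12_sqrt l0).
rewrite (powRM _ (powR_ge0 _ _) (powR_ge0 _ _)) (powRM _ x0 (powR_ge0 _ _)).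
rewrite -(powRrM x p^-1 q) -(powRrM l 2^-1 q) -(powRrM l (p / 2) (q / p)).
by congr (_ `^ _ * _ `^ _); field; rewrite gt_eqF.
Qed.

Theorem mainTheorem4 (R : realType) (p q : R) (hp1 : 1 < p) (hp2 : p < 2)
  (hq : 2 < q) (hpq : q^-1 * log2 (central_binomial q) <= p^-1)
  (d : nat) (hd : (1 <= d)%N) (E : {set d.-tuple bool})
  (r : R) (hr0 : 0 <= r) (hr1 : r < 1) :
  (Lnorm (torus_measure R d) q%:E
     (fun t => (Num.sqrt (ln (ComplexField.Normc.normc (root_entry E r t) ^+ 2)))%:E)
   <= (#|E|%:R `^ p^-1 * Num.sqrt (ln (1 / (1 - r ^+ 2))))%:E)%E.
Proof.
have p0 : 0 < p by exact: lt_trans hp1.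
have q0 : 0 < q by exact: lt_trans hq.
set l := ln (1 / (1 - r ^+ 2)).
have l0 : 0 <= l.
  have r2 : 0 < 1 - r ^+ 2 by rewrite subr_gt0 expr_lt1.
  by rewrite /l div1r ln_ge0// invf_ge1// gerBl sqr_ge0.
have := @node_energy_le R d E r hr0 hr1 q p d [::] hq hp1 hp2 (critical_exponent p0 hq hpq)
  (add0n d).
rewrite leaves_below_nil -/l => H.
apply: (@Lnorm_le _ _ _ (torus_measure R d)
  (fun t => Num.sqrt (logsq (node_mx (leaf_mx E r) t d [::])))) => //.
have -> : (#|E|%:R `^ p^-1 * Num.sqrt l) `^ q = (#|E|%:R * l `^ (p / 2)) `^ (q / p).
  exact: powR_sqrt_mul.
apply: le_trans H; rewrite le_eqVlt; apply/orP; left; apply/eqP.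
apply: eq_integral => t _; rewrite -powR12_sqrt; last exact/logsq_ge0/su11_node/su11_leaf.
by rewrite -powRrM mulrC.
Qed.
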